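(* Let $R$ be a standard graded $\mathsf{k}$-algebra over an infinite field $\mathsf{k}$, and let $I$ be a homogeneous ideal of $R$ such that $\operatorname{codim}(R/I)=\operatorname{pdim}_R(R/I)=2$. If $R/I$ is a pure $R$-module, then there exist an $R$-regular sequence $g_1,g_2$ of homogeneous elements and a positive integer $i$ such that $\beta^R(R/I)=\beta^R(R/\langle g_1,g_2\rangle^i)$.
   Context: A standard graded $\mathsf{k}$-algebra is a graded ring $R=\bigoplus_{i\ge 0}R_i$ with $R_0=\mathsf{k}$, generated as a $\mathsf{k}$-algebra by finitely many elements of degree $1$. For a finitely generated graded $R$-module $M\neq 0$, $\operatorname{codim}(M)=\dim(R)-\dim(M)$ and $\operatorname{pdim}_R(M)$ is the projective dimension. The graded Betti numbers are $\beta^R_{i,j}(M)=\dim_{\mathsf{k}}(\operatorname{Tor}^R_i(M,\mathsf{k})_j)$, and $\beta^R(M)$ is the table $(\beta^R_{i,j}(M))_{i,j}$ of all graded Betti numbers. The module $M$ is pure if for each $i$ there is at most one $j$ with $\beta^R_{i,j}(M)\neq 0$. A regular sequence is assumed to generate a proper ideal. *)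

(* Defs.v *)
From HB Require Import structures.
From mathcomp Require Import all_boot all_order all_algebra.
From mathcomp Require Import boolp classical_sets functions cardinality.

Set Implicit Arguments.
Unset Strict Implicit.
Unset Printing Implicit Defensive.

Import Order.TTheory GRing.Theory.

Local Open Scope classical_set_scope.
Local Open Scope ring_scope.
Local Open Scope quotient_scope.

Section QuotientModule.
Variables (R : nzRingType) (V : lmodType R) (U : submodClosed V).

(* [submodClosed] does not inherit from [zmodClosed], which [Quotient.quot]
   expects; hence this copy of [U]. *)
Definition submod_pred : {pred V} := fun x => x \in U.

Let submod_pred_closed : zmod_closed submod_pred.
Proof. exact: submodClosedP U. Qed.

HB.instance Definition _ := GRing.isZmodClosed.Build V submod_pred
  submod_pred_closed.

Definition modquot : Type := Quotient.quot submod_pred.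

HB.instance Definition _ := GRing.Zmodule.on modquot.
HB.instance Definition _ := Quotient.on modquot.

Definition modquot_scale (a : R) (x : modquot) : modquot :=
  \pi_modquot (a *: repr x).

Lemma modquot_eq (x y : V) : (x - y \in U) = (\pi_modquot x == \pi_modquot y).
Proof. exact: (@Quotient.idealrBE V submod_pred x y). Qed.

Lemma modquot_piD (x y : V) :
  \pi_modquot (x + y) = \pi_modquot x + \pi_modquot y.
Proof. exact: (@Quotient.pi_add V submod_pred x y). Qed.

Lemma modquot_piZ (a : R) (x : V) :
  modquot_scale a (\pi_modquot x) = \pi_modquot (a *: x).
Proof.
apply/eqP; rewrite /modquot_scale -modquot_eq -scalerBr rpredZ //.
by rewrite modquot_eq reprK.
Qed.

Let scalerA_ a b x :
  modquot_scale a (modquot_scale b x) = modquot_scale (a * b) x.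
Proof.
by elim/quotW: x => x; rewrite (modquot_piZ b) (modquot_piZ a) modquot_piZ scalerA.
Qed.

Let scale1r_ : left_id 1 modquot_scale.
Proof. by elim/quotW => x; rewrite modquot_piZ scale1r. Qed.

Let scalerDr_ : right_distributive modquot_scale +%R.
Proof.
move=> a; elim/quotW => x; elim/quotW => y.
by rewrite -modquot_piD !(modquot_piZ a) scalerDr modquot_piD.
Qed.

Let scalerDl_ x : {morph modquot_scale^~ x : a b / a + b}.
Proof.
elim/quotW: x => x a b.
by rewrite (modquot_piZ a) (modquot_piZ b) modquot_piZ scalerDl modquot_piD.
Qed.

HB.instance Definition _ := GRing.Zmodule_isLmodule.Build R modquot
  scalerA_ scale1r_ scalerDr_ scalerDl_.

End QuotientModule.

(** An ideal of a commutative ring [R] is a submodule of the regular module [R^o],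
i.e. an element of [submodClosed R^o]; the unit ideal is allowed. *)

Section Ideals.
Variable R : comNzRingType.

Definition idgen (S : set R) : {pred R^o} := fun x : R =>
  `[< exists n (a b : 'I_n -> R),
        (forall t, S (b t)) /\ x = \sum_t a t * b t >].

Lemma idgen_closed (S : set R) : subsemimod_closed (idgen S).
Proof.
split; [split|].
- apply/asboolP; exists 0%N, (fun=> 0), (fun=> 0).
  by split=> [[]|] //; rewrite big_ord0.
- move=> x y /asboolP[n [a [b [bS ->]]]] /asboolP[m [a' [b' [bS' ->]]]].
  apply/asboolP; exists (n + m)%N.
  exists (fun t => match fintype.split t with inl u => a u | inr u => a' u end).
  exists (fun t => match fintype.split t with inl u => b u | inr u => b' u end).
  split=> [t|]; first by case: fintype.split.
  rewrite big_split_ord /=; congr (_ + _); apply: eq_bigr => t _.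
    by rewrite (unsplitK (inl t)).
  by rewrite (unsplitK (inr t)).
- move=> c x /asboolP[n [a [b [bS ->]]]]; apply/asboolP.
  exists n, (fun t => c * a t), b; split=> //.
  by rewrite scaler_sumr; apply: eq_bigr => t _; rewrite -mulrA.
Qed.

HB.instance Definition _ (S : set R) :=
  GRing.isSubmodClosed.Build R R^o (idgen S) (idgen_closed S).

Definition ideal_span (S : set R) : submodClosed R^o := idgen S.

Definition ideal_exp (I : submodClosed R^o) (n : nat) : submodClosed R^o :=
  ideal_span [set x | exists f : 'I_n -> R,
    (forall t, f t \in I) /\ x = \prod_t f t].

Definition regular_sequence (s : seq R) : Prop :=
  (forall t, (t < size s)%N -> forall x : R,
     s`_t * x \in ideal_span [set` take t s] ->
     x \in ideal_span [set` take t s]) /\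
  (1 : R) \notin ideal_span [set` s].

End Ideals.

Section Dimension.
Variable R : comNzRingType.

Definition annihilator (M : lmodType R) : set R :=
  [set r | forall x : M, r *: x = 0].

Definition prime_chain (S : set R) (n : nat) : Prop :=
  exists p : 'I_n.+1 -> prime_idealr R,
    (forall t, S `<=` [set x | x \in p t]) /\
    (forall s t : 'I_n.+1, (s < t)%N ->
       [set x | x \in p s] `<` [set x | x \in p t]).

(** [module_dim M n] : the Krull dimension of [M], i.e. that of
    [R / Ann M], is [n].  The zero module has no dimension in this sense. *)
Definition module_dim (M : lmodType R) (n : nat) : Prop :=
  prime_chain (annihilator M) n /\
  forall m, prime_chain (annihilator M) m -> (m <= n)%N.

Definition module_codim (M : lmodType R) (c : nat) : Prop :=
  exists m n, [/\ module_dim R^o m, module_dim M n & m = (n + c)%N].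

End Dimension.

Section ProjectiveDimension.
Variable R : comNzRingType.

Definition projective (P : lmodType R) : Prop :=
  forall (A B : lmodType R) (f : {linear A -> B}) (g : {linear P -> B}),
    (forall b, exists a, f a = b) ->
    exists h : {linear P -> A}, forall x, f (h x) = g x.

Definition pdim_le (M : lmodType R) (n : nat) : Prop :=
  exists (P : nat -> lmodType R) (d : forall i, {linear P i.+1 -> P i})
         (e : {linear P 0 -> M}),
    [/\ forall i, projective (P i),
        forall i, (n < i)%N -> forall x : P i, x = 0,
        forall y, exists x, e x = y,
        forall x, e x = 0 <-> exists y, x = d 0 y
      & forall i (x : P i.+1), d i x = 0 <-> exists y, x = d i.+1 y].

Definition pdim (M : lmodType R) (n : nat) : Prop :=
  pdim_le M n /\ forall m, pdim_le M m -> (n <= m)%N.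

End ProjectiveDimension.

Section Graded.
Variables (k : fieldType) (R : comAlgType k).

Record standard_graded (gr : nat -> set R) : Prop := StandardGraded {
  gr_zero : forall i, gr i 0;
  gr_linear : forall i (a : k) x y, gr i x -> gr i y -> gr i (a *: x + y);
  gr_mul : forall i j x y, gr i x -> gr j y -> gr (i + j)%N (x * y);
  gr_span : forall x, exists n (f : nat -> R),
    (forall t, gr t (f t)) /\ x = \sum_(t < n) f t;
  gr_direct : forall n (f : nat -> R),
    (forall t, gr t (f t)) -> \sum_(t < n) f t = 0 ->
    forall t, (t < n)%N -> f t = 0;
  gr_deg0 : gr 0%N = [set x | exists c : k, x = c%:A];
  gr_generated : exists s : seq R,
    (forall x, x \in s -> gr 1%N x) /\
    (forall S : {pred R}, subalg_closed S -> {subset s <= S} ->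
       forall x, x \in S)
}.

Variable gr : nat -> set R.

Definition homogeneous (x : R) : Prop := exists i, gr i x.

Definition homogeneous_ideal (I : submodClosed R^o) : Prop :=
  forall x : R, x \in I -> exists n (f : nat -> R),
    (forall t, gr t (f t) /\ f t \in I) /\ x = \sum_(t < n) f t.

Definition grz (j : int) : set R := if j is Posz i then gr i else [set 0].

Definition quot_gr (I : submodClosed R^o) (j : int) : set (modquot I) :=
  [set \pi_(modquot I) r | r in grz j].

Definition irrelevant : set R :=
  [set x | exists n (f : nat -> R),
     (forall t, gr t.+1 (f t)) /\ x = \sum_(t < n) f t].

(** The projection of [R] onto [k = R / irrelevant]. *)
Definition residue (x : R) : k := xget 0 [set c : k | irrelevant (x - c%:A)].

Section Betti.
Variables (M : lmodType R) (grM : int -> set M).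

(** [... -> F_1 -> F_0 -> M -> 0] with [F_i] free of finite rank [rk i] on a
    homogeneous basis whose [a]-th element has degree [dg i a].  Elements of
    [F_i] are row vectors; [dif i] is the matrix of [F_(i+1) -> F_i] and
    [aug] the images in [M] of the basis of [F_0]. *)
Record graded_resolution := GradedResolution {
  rk : nat -> nat;
  dg : forall i, 'I_(rk i) -> int;
  dif : forall i, 'M[R]_(rk i.+1, rk i);
  aug : 'I_(rk 0) -> M;
  aug_deg : forall b, grM (dg b) (aug b);
  dif_deg : forall i a b, grz (dg a - dg b) (dif i a b);
  aug_surj : forall y : M, exists v : 'rV[R]_(rk 0),
    y = \sum_b v 0 b *: aug b;
  aug_exact : forall v : 'rV[R]_(rk 0),
    \sum_b v 0 b *: aug b = 0 <-> exists w, v = w *m dif 0;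
  dif_exact : forall i (v : 'rV[R]_(rk i.+1)),
    v *m dif i = 0 <-> exists w, v = w *m dif i.+1
}.

(** [Tor_i(M, k)_j] is the homology in degree [j] of the complex [F (x)_R k],
    whose terms are the graded spaces [k^(rk i)] and whose differentials are
    the matrices [map_mx residue (dif i)].  Subspaces are row spaces. *)
Definition degree_part (F : graded_resolution) (i : nat) (j : int) :
    'M[k]_(rk F i) :=
  diag_mx (\row_a (dg (g := F) a == j)%:R).

Definition tor_dif (F : graded_resolution) (i : nat) :
    'M[k]_(rk F i.+1, rk F i) :=
  map_mx residue (dif F i).

Definition tor_cycles (F : graded_resolution) (i : nat) (j : int) :
    'M[k]_(rk F i) :=
  match i return 'M[k]_(rk F i) with
  | 0 => degree_part F 0 j
  | i'.+1 => (degree_part F i'.+1 j :&: kermx (tor_dif F i'))%MS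
  end.

Definition tor_boundaries (F : graded_resolution) (i : nat) (j : int) :
    'M[k]_(rk F i.+1, rk F i) :=
  degree_part F i.+1 j *m tor_dif F i.

Definition tor_dim (F : graded_resolution) (i : nat) (j : int) : nat :=
  (\rank (tor_cycles F i j) - \rank (tor_boundaries F i j))%N.

(** Every finitely generated graded module over a standard graded algebra has
    a graded resolution as above, and [tor_dim] does not depend on it. *)
Definition betti (i : nat) (j : int) : nat :=
  xget 0%N [set b | exists F : graded_resolution, b = tor_dim F i j].

Definition pure : Prop :=
  forall i j j', betti i j != 0%N -> betti i j' != 0%N -> j = j'.

End Betti.

End Graded.

(* Main.v *)
Require Import Defs.
From mathcomp Require Import all_boot all_order all_algebra.
From mathcomp Require Import boolp classical_sets functions cardinality.
From HB Require Import structures.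

(** The minimal graded resolution of [R/I] has length 2, because a projective
resolution of length 2 splits the inclusion of the next syzygy module [K] and
minimality then gives [K = m K = 0].  By purity its matrix [phi] has entries of
a single degree [c].  McCoy's theorem shows that [phi] has size [n x (n+1)] and
that [I = a I_n(phi)] for some [a], which may be taken homogeneous.  If [a] had
positive degree then [I] would lie in a hypersurface, contradicting codimension
2; this is proved by comparing lengths of chains of primes with the growth of
the filtration by degree (the members of [p_(i+1)] outside [p_i] along a chain
are algebraically independent).  So [I] is generated in degree [c n] with
syzygies in degree [c (n+1)].  Since [phi] is injective, and stays so modulo any
nonzerodivisor of [R], two generic combinations [g1], [g2] of the entries of one
row of [phi] form a regular sequence of degree [c], and [(g1, g2)^n] has a
minimal resolution with the same ranks and degrees. *)

Set Implicit Arguments.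
Unset Strict Implicit.
Unset Printing Implicit Defensive.

Import Order.TTheory GRing.Theory Num.Theory.

Local Open Scope classical_set_scope.
Local Open Scope ring_scope.

(** * Homogeneous components *)

(** [R] may have zero divisors and nilpotents, so ranks cannot be read off over a field of
    fractions. Faithfulness of an ideal of minors (only 0 kills it) takes the place of a nonzero
    determinant, and a generic combination turns it into a genuine nonzerodivisor; this is where the
    infinite field enters. [betti] selects a value from the set of values over all graded
    resolutions, so nothing can be computed before the comparison theorem shows this set to be a
    singleton. The exponent of the power is the rank [n] of the second syzygies, positive since
    projective dimension 1 is excluded. Codimension is a difference of lengths of chains of primes;
    the inequality dim R/(x) >= dim R - 1 that it calls for comes from upper bounds O(N^c) on the
    dimension of a quotient in degrees at most N: such bounds pass from Q + (x) to Q at the cost of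
    one exponent, and a long chain violates them. *)

Section Grading.
Variables (k : fieldType) (R : comAlgType k) (gr : nat -> set R).
Hypothesis hgr : standard_graded gr.

Lemma grD i x y : gr i x -> gr i y -> gr i (x + y).
Proof. by move=> hx hy; rewrite -[x]scale1r; apply: (gr_linear hgr). Qed.

Lemma grZ i (c : k) x : gr i x -> gr i (c *: x).
Proof.
by move=> hx; rewrite -[_ *: _]addr0; apply: (gr_linear hgr) => //; apply: (gr_zero hgr).
Qed.

Lemma grB i x y : gr i x -> gr i y -> gr i (x - y).
Proof. by move=> hx hy; rewrite -scaleN1r; apply: grD => //; apply: grZ. Qed.

Lemma gr_scalar (c : k) : gr 0%N c%:A.
Proof. by rewrite (gr_deg0 hgr); exists c. Qed.

Let gr_eq_aux n (f g : nat -> R) : (forall t, gr t (f t)) -> (forall t, gr t (g t)) ->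
  \sum_(t < n) f t = \sum_(t < n) g t -> forall t, (t < n)%N -> f t = g t.
Proof.
move=> hf hg e t ltn; apply/eqP; rewrite -subr_eq0; apply/eqP.
apply: (gr_direct hgr (n := n) (f := fun t => f t - g t)) => // [s|].
  exact: grB.
by rewrite sumrB e subrr.
Qed.

Let decomp (x : R) : {nf : nat * (nat -> R) |
  (forall t, gr t (nf.2 t)) /\ x = \sum_(t < nf.1) nf.2 t}.
Proof.
by apply: cid; have [n [f h]] := gr_span hgr x; exists (n, f).
Qed.

(** The chosen decomposition is extended by 0 beyond its length, so that components exist in every
    degree; [hcn_uniq] shows that the choice does not matter. *)
Definition hcn (t : nat) (x : R) : R :=
  if (t < (sval (decomp x)).1)%N then (sval (decomp x)).2 t else 0.

Let pad (n N : nat) (f : nat -> R) : (n <= N)%N ->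
  \sum_(t < N) (if (t < n)%N then f t else 0) = \sum_(t < n) f t.
Proof.
by move=> le_nN; rewrite (big_ord_widen N f le_nN) [RHS]big_mkcond.
Qed.

Lemma hcn_gr t x : gr t (hcn t x).
Proof.
rewrite /hcn; case: decomp => -[n f] /= [hf _].
by case: ifP => // _; apply: (gr_zero hgr).
Qed.

Lemma hcn_decomp x : exists n, forall N, (n <= N)%N -> x = \sum_(t < N) hcn t x.
Proof.
rewrite /hcn; case: (decomp x) => -[n f] /= [hf e].
by exists n => N le_nN; rewrite pad.
Qed.

Lemma hcn_uniq n f x : (forall t, gr t (f t)) -> x = \sum_(t < n) f t ->
  forall t, hcn t x = if (t < n)%N then f t else 0.
Proof.
move=> hf e t; have [m hm] := hcn_decomp x.
apply: (@gr_eq_aux (maxn t.+1 (maxn m n)) (hcn^~ x)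
          (fun t => if (t < n)%N then f t else 0)); last by rewrite leq_maxl.
- by move=> s; apply: hcn_gr.
- by move=> s; case: ifP => // _; apply: (gr_zero hgr).
rewrite -hm; last by rewrite !leq_max leqnn !orbT.
by rewrite pad ?e // !leq_max leqnn !orbT.
Qed.

Lemma hcn_linear t (c : k) x y : hcn t (c *: x + y) = c *: hcn t x + hcn t y.
Proof.
have [n hn] := hcn_decomp x; have [m hm] := hcn_decomp y.
pose N := maxn t.+1 (maxn n m).
rewrite (@hcn_uniq N (fun t => c *: hcn t x + hcn t y)) ?leq_maxl //.
  by move=> s; apply: (gr_linear hgr); apply: hcn_gr.
rewrite big_split -scaler_sumr -hn -?hm //; by rewrite !leq_max leqnn !orbT.
Qed.

(* [hc j x] is the homogeneous component of degree [j] of [x]. *)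
Definition hc (j : int) (x : R) : R := if j is Posz t then hcn t x else 0.

Lemma hc_linear j (c : k) x y : hc j (c *: x + y) = c *: hc j x + hc j y.
Proof. by case: j => t /=; rewrite ?hcn_linear // scaler0 addr0. Qed.

Lemma hc0 j : hc j 0 = 0.
Proof. by have := hc_linear j (-1) 0 0; rewrite scaler0 addr0 scaleN1r addNr. Qed.

Lemma hcD j x y : hc j (x + y) = hc j x + hc j y.
Proof. by rewrite -[x in LHS]scale1r hc_linear scale1r. Qed.

Lemma hcZ j (c : k) x : hc j (c *: x) = c *: hc j x.
Proof. by rewrite -[_ *: x]addr0 hc_linear hc0 addr0. Qed.

Lemma hcB j x y : hc j (x - y) = hc j x - hc j y.
Proof. by rewrite -scaleN1r hcD hcZ scaleN1r. Qed.

Lemma hc_sum j (T : Type) (r : seq T) (P : pred T) (F : T -> R) :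
  hc j (\sum_(i <- r | P i) F i) = \sum_(i <- r | P i) hc j (F i).
Proof. exact: (big_morph _ (hcD j) (hc0 j)). Qed.

Lemma grz0 j : grz gr j 0.
Proof. by case: j => t /=; first apply: (gr_zero hgr). Qed.

Lemma grzD j x y : grz gr j x -> grz gr j y -> grz gr j (x + y).
Proof. by case: j => t /=; [apply: grD | move=> -> ->; rewrite addr0]. Qed.

Lemma grzZ j (c : k) x : grz gr j x -> grz gr j (c *: x).
Proof. by case: j => t /=; [apply: grZ | move=> ->; rewrite scaler0]. Qed.

Lemma grzN j x : grz gr j x -> grz gr j (- x).
Proof. by rewrite -scaleN1r; apply: grzZ. Qed.

Lemma grzM i j x y : grz gr i x -> grz gr j y -> grz gr (i + j) (x * y).
Proof.
case: i => [i|i]; case: j => [j|j] /=; last 3 first.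
- by move=> _ ->; rewrite mulr0; apply: grz0.
- by move=> -> _; rewrite mul0r; apply: grz0.
- by move=> -> _; rewrite mul0r.
exact: (gr_mul hgr).
Qed.

Lemma grz_sum j (T : Type) (r : seq T) (P : pred T) (F : T -> R) :
  (forall i, P i -> grz gr j (F i)) -> grz gr j (\sum_(i <- r | P i) F i).
Proof. by move=> h; apply: big_ind => //; [apply: grz0 | apply: grzD]. Qed.

Lemma grz_prod m (c : int) (F : 'I_m -> R) :
  (forall i, grz gr c (F i)) -> grz gr (c * m%:Z) (\prod_i F i).
Proof.
elim: m F => [|m IH] F hF.
  by rewrite big_ord0 mulr0 -[1]scale1r; apply: gr_scalar.
by rewrite big_ord_recl intS mulrDr mulr1; apply: grzM => //; apply: IH.
Qed.

Lemma grz_det m (c : int) (A : 'M[R]_m) :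
  (forall a b, grz gr c (A a b)) -> grz gr (c * m%:Z) (\det A).
Proof.
move=> hA; apply: grz_sum => s _.
rewrite mulr_sign; case: ifP => _; last exact: grz_prod.
by apply: grzN; apply: grz_prod.
Qed.

Lemma hc_grz j x : grz gr j (hc j x).
Proof. by case: j => t //=; apply: hcn_gr. Qed.

Lemma hc_homog j i x : grz gr i x -> hc j x = if i == j then x else 0.
Proof.
case: i => [i|i] /= hx; last by rewrite hx hc0 if_same.
case: j => [j|j] //=.
rewrite (@hcn_uniq i.+1 (fun t => if t == i then x else 0)) //.
- rewrite eqz_nat [i == j]eq_sym; case: (ltngtP j i) => [|lt_ij|->].
  + by move=> lt_ji; rewrite ltnS ltnW.
  + by rewrite ltnS leqNgt lt_ij.
  + by rewrite ltnSn.
- by move=> t; case: eqP => [->|_] //; apply: (gr_zero hgr).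
- rewrite (bigD1 ord_max) //= eqxx big1 ?addr0 // => s.
  by rewrite -val_eqE /= => /negPf ->.
Qed.

Lemma hc_id j x : grz gr j x -> hc j x = x.
Proof. by move=> /(hc_homog j); rewrite eqxx. Qed.

Lemma hc_decomp x : exists n, forall N, (n <= N)%N -> x = \sum_(t < N) hc t%:Z x.
Proof. exact: hcn_decomp. Qed.

Lemma hc_inj x y : (forall j, hc j x = hc j y) -> x = y.
Proof.
move=> h; have [n hn] := hc_decomp x; have [m hm] := hc_decomp y.
rewrite (hn (maxn n m)) ?leq_maxl // [y](hm (maxn n m)) ?leq_maxr //.
by apply: eq_bigr.
Qed.

Lemma hcMr i j x a : grz gr i a -> hc j (x * a) = hc (j - i) x * a.
Proof.
move=> ha; have [n hn] := hc_decomp x; have {1}-> := hn n (leqnn n).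
rewrite mulr_suml hc_sum {2}(hn n (leqnn n)) hc_sum mulr_suml.
apply: eq_bigr => t _.
rewrite (@hc_homog _ (t%:Z + i)); last by apply: grzM => //; apply: hc_grz.
rewrite (@hc_homog (j - i) t%:Z); last exact: hc_grz.
by rewrite [t%:Z + i == j](can2_eq (addrK i) (subrK i)); case: ifP; rewrite ?mul0r.
Qed.

Lemma hcMl i j x a : grz gr i a -> hc j (a * x) = a * hc (j - i) x.
Proof. by move=> ha; rewrite mulrC (@hcMr i) // mulrC. Qed.

Lemma scalar_inj (c d : k) : c%:A = d%:A :> R -> c = d.
Proof.
move=> /eqP; rewrite -subr_eq0 -scalerBl scaler_eq0 oner_eq0 orbF subr_eq0.
by move/eqP.
Qed.

Lemma irrelevantP x : irrelevant gr x <-> hc 0 x = 0.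
Proof.
split=> [[n [f [hf ->]]]|h].
  rewrite hc_sum big1 // => t _.
  by rewrite (@hc_homog 0 t.+1%:Z) //; apply: hf.
have [n hn] := hc_decomp x; exists n, (fun t => hcn t.+1 x); split.
  by move=> t; apply: hcn_gr.
by rewrite {1}(hn n.+1) // big_ord_recl h add0r.
Qed.

Lemma hc_residue x : hc 0 x = (residue gr x)%:A.
Proof.
have: gr 0%N (hcn 0 x) by apply: hcn_gr.
rewrite (gr_deg0 hgr) => -[c]; rewrite -[hcn 0 x]/(hc 0 x) => hcx.
rewrite hcx; congr (_ *: _); rewrite /residue.
have P (d : k) : irrelevant gr (x - d%:A) <-> c = d.
  rewrite irrelevantP hcB hcx (@hc_id _ d%:A); last exact: gr_scalar.
  split=> [/eqP|->]; last by rewrite subrr.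
  by rewrite subr_eq0 => /eqP /scalar_inj.
by case: xgetP => [d _ /P //|/(_ c) []]; apply/P.
Qed.

Lemma residueP x c : hc 0 x = c%:A -> residue gr x = c.
Proof. by rewrite hc_residue => /scalar_inj. Qed.

Lemma residueD x y : residue gr (x + y) = residue gr x + residue gr y.
Proof. by apply: residueP; rewrite hcD !hc_residue scalerDl. Qed.

Lemma residue0 : residue gr 0 = 0.
Proof. by apply: residueP; rewrite hc0 scale0r. Qed.

Lemma residue_scalar c : residue gr c%:A = c.
Proof. by apply: residueP; rewrite hc_id //; apply: gr_scalar. Qed.

Lemma residue1 : residue gr 1 = 1.
Proof. by rewrite -[1]scale1r residue_scalar. Qed.

Lemma residue_eq0 x : residue gr x = 0 <-> hc 0 x = 0.
Proof.
rewrite hc_residue; split=> [->|]; first by rewrite scale0r.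
by rewrite -[RHS](scale0r (1 : R)) => /scalar_inj.
Qed.

Lemma residue_grz j x : j != 0 -> grz gr j x -> residue gr x = 0.
Proof. by move=> /negPf j0 /(hc_homog 0); rewrite j0 => /residue_eq0. Qed.

Lemma hc0M x y : hc 0 (x * y) = hc 0 x * hc 0 y.
Proof.
have [n hn] := hc_decomp x; rewrite {1}(hn n.+1) // mulr_suml hc_sum.
rewrite big_ord_recl big1 ?addr0 => [|t _].
  by rewrite (@hcMl 0) ?subr0 //; apply: hc_grz.
by rewrite (@hcMl (lift ord0 t)%:Z) ?mulr0 //; apply: hc_grz.
Qed.

Lemma residueM x y : residue gr (x * y) = residue gr x * residue gr y.
Proof.
apply: residueP; rewrite hc0M !hc_residue.
by rewrite -scalerAl mul1r scalerA.
Qed.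

Lemma residue_sum (T : Type) (r : seq T) (P : pred T) (F : T -> R) :
  residue gr (\sum_(i <- r | P i) F i) = \sum_(i <- r | P i) residue gr (F i).
Proof. exact: (big_morph _ residueD residue0). Qed.

Lemma residue_mulmx m n p (A : 'M_(m, n)) (B : 'M_(n, p)) :
  map_mx (residue gr) (A *m B) = map_mx (residue gr) A *m map_mx (residue gr) B.
Proof.
apply/matrixP => a b; rewrite !mxE residue_sum.
by apply: eq_bigr => c _; rewrite residueM !mxE.
Qed.

End Grading.

Arguments hc : simpl never.

(** * Noetherian rings *)

(** Dependent choice with the whole history as argument: it turns the failure of a finiteness
    statement into an infinite sequence that contradicts [noeth]. *)
Lemma seq_choice (T : Type) (P : seq T -> T -> Prop) :
  (forall s, exists x, P s x) -> exists a : nat -> T, forall n, P (mkseq a n) (a n).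
Proof.
move=> /choice[c hc].
pose S := fix S n := if n is m.+1 then rcons (S m) (c (S m)) else [::].
have ES n : mkseq (fun m => c (S m)) n = S n.
  by elim: n => [//|n IH]; rewrite mkseqS IH.
by exists (fun n => c (S n)) => n; rewrite ES.
Qed.

Section Noetherian.
Variable A : comNzRingType.

Definition is_ideal (Q : set A) : Prop :=
  [/\ Q 0, forall x y, Q x -> Q y -> Q (x + y) & forall a x, Q x -> Q (a * x)].

Definition gens (s : seq A) : set A :=
  [set x | exists u : nat -> A, x = \sum_(i < size s) u i * s`_i].

(* Over countable choice this is the ascending chain condition. *)
Definition noeth : Prop :=
  forall a : nat -> A, exists n, gens (mkseq a n) (a n).

Lemma idealN Q x : is_ideal Q -> Q x -> Q (- x).
Proof. by case=> _ _ h Qx; rewrite -mulN1r; apply: h. Qed.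

Lemma idealB Q x y : is_ideal Q -> Q x -> Q y -> Q (x - y).
Proof. by move=> iQ Qx Qy; case: (iQ) => _ h _; apply: h => //; apply: idealN. Qed.

Lemma ideal_mulr Q x a : is_ideal Q -> Q x -> Q (x * a).
Proof. by case=> _ _ h Qx; rewrite mulrC; apply: h. Qed.

Lemma ideal_sum Q (T : Type) (r : seq T) (P : pred T) (F : T -> A) :
  is_ideal Q -> (forall i, P i -> Q (F i)) -> Q (\sum_(i <- r | P i) F i).
Proof. by case=> Q0 QD _ h; apply: big_ind. Qed.

Lemma gens_ideal s : is_ideal (gens s).
Proof.
split=> [|x y [u ->] [v ->]|a x [u ->]].
- by exists (fun=> 0); rewrite big1 // => i _; rewrite mul0r.
- by exists (fun i => u i + v i); rewrite -big_split; apply: eq_bigr => i _; rewrite mulrDl.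
- exists (fun i => a * u i); rewrite mulr_sumr; apply: eq_bigr => i _.
  by rewrite mulrA.
Qed.

Lemma gens_mem s x : x \in s -> gens s x.
Proof.
move=> xs; exists (fun i => (i == index x s)%:R).
have ltx : (index x s < size s)%N by rewrite index_mem.
rewrite (bigD1 (Ordinal ltx)) //= eqxx mul1r nth_index // big1 ?addr0 // => i.
by rewrite -val_eqE /= => /negPf ->; rewrite mul0r.
Qed.

Lemma gens_sub s Q : is_ideal Q -> (forall x, x \in s -> Q x) -> gens s `<=` Q.
Proof.
move=> iQ h x [u ->]; apply: ideal_sum => // i _; case: (iQ) => _ _; apply.
exact/h/mem_nth.
Qed.

Lemma gens_mono s s' : {subset s <= s'} -> gens s `<=` gens s'.
Proof. by move=> h; apply: gens_sub (gens_ideal _) _ => x /h; apply: gens_mem. Qed.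

Lemma noeth_fg Q : noeth -> is_ideal Q ->
  exists s, (forall x, x \in s -> Q x) /\ Q `<=` gens s.
Proof.
move=> hA iQ; apply: contrapT => hn.
have [|a ha] := @seq_choice A (fun s x => (forall y, y \in s -> Q y) -> Q x /\ ~ gens s x).
  move=> s; apply: contrapT => hs; apply: hn; exists s; split=> [y ys|x Qx].
    by apply: contrapT => nQy; apply: hs; exists y => /(_ y ys).
  by apply: contrapT => nx; apply: hs; exists x.
have Qa n : Q (a n).
  elim/ltn_ind: n => n IH; have [] // := ha n.
  by move=> y /mapP[i]; rewrite mem_iota => /andP[_ /IH] ? ->.
have [n hn'] := hA a; have [|_ nh] := ha n; last exact: nh.
by move=> y /mapP[i _ ->].
Qed.

Lemma fg_noeth :
  (forall Q, is_ideal Q -> exists s, (forall x, x \in s -> Q x) /\ Q `<=` gens s) -> noeth.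
Proof.
move=> h a; pose Q : set A := [set x | exists n, gens (mkseq a n) x].
have mono n m : (n <= m)%N -> gens (mkseq a n) `<=` gens (mkseq a m).
  move=> le_nm; apply: gens_mono => x /mapP[i]; rewrite mem_iota => /andP[_ lti] ->.
  by apply: map_f; rewrite mem_iota /= (leq_trans lti).
have iQ : is_ideal Q.
  split=> [|x y [n hx] [m hy]|b x [n hx]].
  - by exists 0%N; case: (gens_ideal (mkseq a 0)).
  - exists (maxn n m); case: (gens_ideal (mkseq a (maxn n m))) => _ + _; apply.
      exact: mono (leq_maxl _ _) _ hx.
    exact: mono (leq_maxr _ _) _ hy.
  - by exists n; case: (gens_ideal (mkseq a n)) => _ _; apply.
have [s [Qs sQ]] := h Q iQ.
have [N hN] : exists N, forall x, x \in s -> gens (mkseq a N) x.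
  elim: s Qs {sQ} => [|y s IH] Qs; first by exists 0%N.
  have [|N hN] := IH; first by move=> x xs; apply: Qs; rewrite inE xs orbT.
  have [|n hn] := Qs y; first by rewrite inE eqxx.
  exists (maxn n N) => x; rewrite inE => /orP[/eqP->|/hN].
    exact: mono (leq_maxl _ _) _ hn.
  exact: mono (leq_maxr _ _) _.
exists N; apply: (gens_sub (gens_ideal _) hN); apply: sQ; exists N.+1.
by apply: gens_mem; apply: map_f; rewrite mem_iota /=.
Qed.

End Noetherian.

Lemma noeth_surj (A B : comNzRingType) (f : {rmorphism A -> B}) :
  (forall b, exists a, f a = b) -> noeth A -> noeth B.
Proof.
move=> fs hA b; have /choice[a ha] : forall n, exists a, f a = b n by move=> n.
have [n [u hu]] := hA a; exists n, (f \o u).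
move: hu => /(congr1 f); rewrite ha rmorph_sum !size_mkseq => ->.
by apply: eq_bigr => i _; rewrite rmorphM !nth_mkseq // ha.
Qed.

Lemma noeth_field (k : fieldType) : noeth k.
Proof.
move=> a; have [a0|a0] := eqVneq (a 0%N) 0.
  by exists 0%N, (fun=> 0); rewrite big_ord0.
by exists 1%N, (fun=> a 1%N / a 0%N); rewrite big_ord1 /= divfK.
Qed.

(** Hilbert's basis theorem. If [Q] is not finitely generated, repeatedly take an element of least
    size outside the ideal of the earlier ones; a relation among the leading coefficients then
    yields a smaller such element. *)
Lemma noeth_poly (A : comNzRingType) : noeth A -> noeth {poly A}.
Proof.
move=> hA; apply: fg_noeth => Q iQ; apply: contrapT => hn.
pose good (s : seq {poly A}) x := Q x /\ ~ gens s x.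
have [|f hf] := @seq_choice {poly A} (fun s x => (forall y, y \in s -> Q y) ->
    good s x /\ forall y, good s y -> (size x <= size y)%N).
  move=> s; have [Qs|nQs] := pselect (forall y, y \in s -> Q y); last by exists 0 => /nQs.
  have ex : exists d, `[< exists2 x, good s x & size x = d >].
    apply: contrapT => hs; apply: hn; exists s; split=> // x Qx.
    apply: contrapT => nx; apply: hs; exists (size x); apply/asboolP.
    by exists x.
  case: (ex_minnP ex) => d /asboolP[x gx sx] dmin; exists x => _; split=> // y gy.
  by rewrite sx; apply: dmin; apply/asboolP; exists y.
have Qf n : Q (f n).
  elim/ltn_ind: n => n IH; have [] // := hf n; last by case.
  by move=> y /mapP[i]; rewrite mem_iota => /andP[_ /IH] ? ->.
have {hf} hf n : ~ gens (mkseq f n) (f n) /\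
    forall y, Q y -> ~ gens (mkseq f n) y -> (size (f n) <= size y)%N.
  have [|[_ h1] h2] := hf n; first by move=> y /mapP[i _ ->].
  by split=> // y Qy gy; apply: h2.
have mem i n : (i < n)%N -> gens (mkseq f n) (f i).
  by move=> lt_in; apply: gens_mem; apply: map_f; rewrite mem_iota.
have szf i n : (i < n)%N -> (size (f i) <= size (f n))%N.
  move=> lt_in; have [_ h] := hf i; apply: h => //.
  have [h _] := hf n; apply: contra_not h; apply: gens_mono.
  move=> y /mapP[j]; rewrite mem_iota => /andP[_ ltj] ->; apply: map_f.
  by rewrite mem_iota /= (ltn_trans ltj).
have [n [u]] := hA (fun n => lead_coef (f n)); rewrite size_mkseq => hu.
(* The shift by a power of ['X] aligns the leading terms, so that [g] loses the leading term of
   [f n]. *)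
pose v (i : 'I_n) := (u i)%:P * 'X^(size (f n) - size (f i)).
pose g := f n - \sum_(i < n) v i * f i.
have gv : gens (mkseq f n) (\sum_(i < n) v i * f i).
  apply: ideal_sum (gens_ideal _) _ => i _.
  by case: (gens_ideal (mkseq f n)) => _ _; apply; apply: mem.
have Qg : Q g.
  apply: idealB => //; apply: ideal_sum => // i _; case: (iQ) => _ _; exact.
have [h1 h2] := hf n.
have sg : (size (f n) <= size g)%N.
  apply: h2 => // gg; apply: h1; rewrite -[f n](subrK (\sum_(i < n) v i * f i)).
  by case: (gens_ideal (mkseq f n)) => _ + _; apply.
have f0 i : (0 < size (f i))%N.
  rewrite lt0n size_poly_eq0; apply/eqP => e; have [+ _] := hf i; rewrite e; apply.
  by case: (gens_ideal (mkseq f i)).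
suff: (size g <= (size (f n)).-1)%N by rewrite leqNgt prednK // sg.
apply/leq_sizeP => j lej; rewrite /g coefB coef_sum.
have E i : (i < n)%N -> ('X^(size (f n) - size (f i)) * f i)`_j =
    (if j == (size (f n)).-1 then lead_coef (f i) else 0).
  move=> lti; have szi := szf _ _ lti; rewrite coefXnM; have [->|nej] := eqVneq.
    rewrite ltnNge -ltnS prednK // ltn_subrL f0 f0 /=.
    by rewrite lead_coefE; congr (_`_ _); rewrite -subn1 -subnDA addnC subnDA subKn // subn1.
  have ltj : (size (f n) <= j)%N.
    by rewrite -(prednK (f0 n)) ltn_neqAle eq_sym nej.
  case: ifP => // _; rewrite nth_default //.
  by rewrite leq_subRL ?(leq_trans (leq_subr _ _)) // subnK.
rewrite (eq_bigr (fun i : 'I_n => u i * (if j == (size (f n)).-1 then lead_coef (f i) else 0))).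
  have [->|nej] := eqVneq.
    rewrite -lead_coefE hu; apply/eqP; rewrite subr_eq0; apply/eqP/eq_bigr => i _.
    by rewrite nth_mkseq.
  rewrite big1 ?subr0 => [|i _]; last by rewrite mulr0.
  by rewrite nth_default // -(prednK (f0 n)) ltn_neqAle eq_sym nej.
by move=> i _; rewrite -mulrA coefCM E.
Qed.

(** [R] is the image of an iterated polynomial ring over [k], with one variable per generator. *)
Lemma noeth_fgalg (k : fieldType) (R : comAlgType k) (s : seq R) :
  (forall S : {pred R}, subalg_closed S -> {subset s <= S} -> forall x, x \in S) ->
  noeth R.
Proof.
move=> hs.
have [B [f [hB fk fs]]] : exists (B : comNzRingType) (f : {rmorphism B -> R}),
    [/\ noeth B, forall c : k, exists b, f b = c%:A & forall x, x \in s -> exists b, f b = x].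
  elim: s {hs} => [|y s [B [f [hB fk fs]]]].
    exists k, (in_alg R); split=> //; first exact: noeth_field.
    by move=> c; exists c.
  pose cfu : commr_rmorph f y := fun x => mulrC _ _.
  exists {poly B}, (horner_morph cfu); split.
  - exact: noeth_poly.
  - by move=> c; have [b <-] := fk c; exists b%:P; rewrite /= horner_morphC.
  - move=> x; rewrite inE => /orP[/eqP->|/fs[b <-]].
      by exists 'X; rewrite /= horner_morphX.
    by exists b%:P; rewrite /= horner_morphC.
apply: (noeth_surj (f := f)) hB => x.
apply/asboolP; apply: (hs (fun x => `[< exists b, f b = x >])).
  split=> [|a u v|u v].
  - by apply/asboolP; exists 1; rewrite rmorph1.
  - move=> /asboolP[b <-] /asboolP[c <-]; have [d hd] := fk a.
    by apply/asboolP; exists (d * b + c); rewrite rmorphD rmorphM hd -scalerAl mul1r.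
  - move=> /asboolP[b <-] /asboolP[c <-].
    by apply/asboolP; exists (b * c); rewrite rmorphM.
by move=> y /fs h; apply/asboolP.
Qed.

(** Split off the first coordinate: the first coordinates of [N] form an ideal, and subtracting
    lifts of its generators leaves vectors with first coordinate 0, to which induction applies. *)
Lemma noeth_mx (A : comNzRingType) : noeth A -> forall m (N : set 'rV[A]_m),
  N 0 -> (forall u v, N u -> N v -> N (u + v)) -> (forall a v, N v -> N (a *: v)) ->
  exists p (B : 'M_(p, m)), (forall i, N (row i B)) /\
    forall v, N v -> exists w, v = w *m B.
Proof.
move=> hA; elim=> [|m IH]; last rewrite -[m.+1]/(1 + m)%N => N N0 ND NZ.
  by move=> N _ _ _; exists 0%N, 0; split=> [[]//|v _]; exists 0; apply/rowP; case.
pose rw (x : A) (v : 'rV[A]_m) : 'rV_(1 + m) := row_mx (x%:M : 'rV_1) v.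
have rwD x y u v : rw x u + rw y v = rw (x + y) (u + v).
  by rewrite /rw add_row_mx raddfD.
have rwZ a x v : a *: rw x v = rw (a * x) (a *: v).
  by rewrite /rw scale_row_mx scale_scalar_mx.
have rwE (v : 'rV_(1 + m)) : exists x u, v = rw x u.
  exists ((lsubmx (v : 'rV_(1 + m))) 0 0), (rsubmx (v : 'rV_(1 + m))).
  by rewrite /rw -mx11_scalar hsubmxK.
pose Q : set A := [set x | exists v, N (rw x v)].
have iQ : is_ideal Q.
  split=> [|x y [u hu] [v hv]|a x [u hu]].
  - by exists 0; rewrite (_ : rw _ _ = 0) // /rw raddf0 row_mx0.
  - by exists (u + v); rewrite -rwD; apply: ND.
  - by exists (a *: u); rewrite -rwZ; apply: NZ.
have [s [Qs sQ]] := noeth_fg hA iQ.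
have /choice[g hg] : forall i : 'I_(size s), exists v, N (rw s`_i v).
  by move=> i; apply: Qs; apply: mem_nth.
have [||| p [B [NB hB]]] := IH [set v | N (rw 0 v)].
- by rewrite /= (_ : rw _ _ = 0) // /rw raddf0 row_mx0.
- by move=> u v /= hu hv; rewrite -[0]addr0 -rwD; apply: ND.
- by move=> a v /= hv; rewrite -[0](mulr0 a) -rwZ; apply: NZ.
pose C1 : 'M[A]_(size s, 1 + m) := row_mx (\col_i s`_i) (\matrix_i g i).
pose C2 : 'M[A]_(p, 1 + m) := row_mx (0 : 'M_(p, 1)) B.
exists (size s + p)%N, (col_mx C1 C2); split=> [i|v Nv].
  rewrite -(splitK i); case: fintype.split => j /=.
    rewrite rowKu rowE mul_mx_row -!rowE rowK.
    by rewrite [row j _]mx11_scalar !mxE; apply: hg.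
  rewrite rowKd rowE mul_mx_row -!rowE row0.
  by have := NB j; rewrite /= /rw raddf0.
have [x [u ev]] := rwE v.
have [|c hc] := sQ x; first by exists u; rewrite -ev.
pose w1 : 'rV[A]_(size s) := \row_i c i.
have e1 : w1 *m C1 = rw x (w1 *m \matrix_i g i).
  rewrite /C1 mul_mx_row; congr row_mx.
  rewrite [LHS]mx11_scalar mxE; congr (_%:M); rewrite hc; apply: eq_bigr => i _.
  by rewrite !mxE.
have Nw : N (w1 *m C1).
  rewrite mulmx_sum_row; apply: big_ind => // i _; apply: NZ.
  rewrite rowE mul_mx_row -!rowE rowK [row i _]mx11_scalar !mxE; exact: hg.
have [|w2 hw2] := hB (u - w1 *m \matrix_i g i).
  rewrite /= -[0](subrr x) -rwD; apply: ND; first by rewrite -ev.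
  rewrite (_ : rw _ _ = -1 *: rw x (w1 *m \matrix_i g i)); last by rewrite rwZ mulN1r scaleN1r.
  by apply: NZ; rewrite -e1.
exists (row_mx w1 w2); rewrite mul_row_col e1 /C2 mul_mx_row mulmx0 -hw2.
rewrite -[row_mx 0 _]/(row_mx 0 (u - _)) (_ : row_mx 0 _ = rw 0 (u - w1 *m \matrix_i g i)).
  by rewrite rwD addr0 addrC subrK.
by rewrite /rw raddf0.
Qed.

(** * Generic nonzerodivisors and McCoy's theorem *)

Section Avoidance.
Variable A : comNzRingType.
Hypothesis hA : noeth A.

Lemma noeth_max (F : set (set A)) Q0 : (forall Q, F Q -> is_ideal Q) -> F Q0 ->
  exists Q, [/\ F Q, Q0 `<=` Q & forall Q', F Q' -> Q `<=` Q' -> Q' `<=` Q].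
Proof.
move=> hF FQ0; apply: contrapT => hn.
pose G Q := F Q /\ Q0 `<=` Q.
have /choice[nx hnx] : forall Q : {Q | G Q}, exists p : {Q | G Q} * A,
    [/\ sval Q `<=` sval p.1, sval p.1 p.2 & ~ sval Q p.2].
  case=> Q [FQ Q0Q] /=; apply: contrapT => h; apply: hn; exists Q; split=> // Q' FQ' QQ' x Q'x.
  apply: contrapT => nQx; apply: h.
  have GQ' : G Q' by split=> //; apply: subset_trans Q0Q QQ'.
  by exists (exist _ _ GQ', x).
have GQ0 : G Q0 by split.
pose S n := iter n (fun Q => (nx Q).1) (exist _ _ GQ0 : {Q | G Q}).
have mono i n : (i <= n)%N -> sval (S i) `<=` sval (S n).
  elim: n => [|n IH]; first by rewrite leqn0 => /eqP ->.
  rewrite leq_eqVlt ltnS => /orP[/eqP ->//|/IH h]; apply: subset_trans h _ => /=.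
  by case: (hnx (S n)).
have [n hn'] := hA (fun n => (nx (S n)).2).
have [_ _] := hnx (S n); apply; apply: gens_sub hn'.
  by apply: hF; case: (svalP (S n)).
move=> x /mapP[i]; rewrite mem_iota => /andP[_ lti] ->.
by apply: (mono i.+1 n) => //=; case: (hnx (S i)).
Qed.

Definition colon (Q : set A) (x : A) : set A := [set a | Q (a * x)].

Lemma colon_ideal Q x : is_ideal Q -> is_ideal (colon Q x).
Proof.
case=> Q0 QD QM; split=> [|a b ha hb|a b hb]; rewrite /colon /=.
- by rewrite mul0r.
- by rewrite mulrDl; apply: QD.
- by rewrite -mulrA; apply: QM.
Qed.

(* The ideals [colon Q y] that are maximal among those with [y] outside [Q] are
   prime; a sequence of pairwise distinct ones would contradict [noeth]. *)
Lemma zero_divisors_cover Q : is_ideal Q ->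
  exists s : seq A, (forall x, x \in s -> ~ Q x) /\
    forall x, ~ Q x -> exists2 y, y \in s & colon Q x `<=` colon Q y.
Proof.
move=> iQ.
pose F : set (set A) := [set P | exists2 x, ~ Q x & P = colon Q x].
pose mx y := ~ Q y /\ forall x, ~ Q x -> colon Q y `<=` colon Q x -> colon Q x `<=` colon Q y.
have max_ex x : ~ Q x -> exists2 y, mx y & colon Q x `<=` colon Q y.
  move=> nQx; have [||P [[y nQy ->] h1 h2]] := @noeth_max F (colon Q x).
  - by move=> P [y _ ->]; apply: colon_ideal.
  - by exists x.
  - by exists y => //; split=> // z nQz; apply: h2; exists z.
have mx_prime y a b : mx y -> colon Q y (a * b) -> ~ colon Q y b -> colon Q y a.
  case=> _ my hab hb; apply: (my (b * y)) => //.
    by move=> c; rewrite /colon /= mulrCA; case: iQ => _ _; apply.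
  by move: hab; rewrite /colon /= mulrA.
(* Finitely many maximal colon ideals suffice; otherwise there is a sequence [y] in which no earlier
   colon ideal is contained in a later one. *)
have [s hs] : exists s : seq A, forall y, mx y ->
    exists2 x, x \in s & mx x /\ colon Q x `<=` colon Q y.
  apply: contrapT => hn.
  have [|y hy] := @seq_choice A (fun s y => mx y /\
      forall x, x \in s -> mx x -> ~ colon Q x `<=` colon Q y).
    move=> s; apply: contrapT => h; apply: hn; exists s => y my.
    apply: contrapT => h1; apply: h; exists y; split=> // x xs mxx xy.
    by apply: h1; exists x.
  have my n : mx (y n) by case: (hy n).
  have [n [u hu]] := hA y.
  (* [c i] kills [y i] but not [y n] modulo [Q]. Since [y n] is a combination of the [y i], the
     product of the [c i] kills it, against primality. *)
  have /choice[c hc] : forall i : 'I_n, exists c, colon Q (y i) c /\ ~ colon Q (y n) c.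
    move=> i; apply: contrapT => h; have [_] := hy n.
    move=> /(_ (y i) _ (my i)); apply; first by apply: map_f; rewrite mem_iota /=.
    by move=> c hci; apply: contrapT => hcn; apply: h; exists c.
  have h1 : colon Q (y n) (\prod_i c i).
    rewrite /colon /= hu size_mkseq mulr_sumr; apply: ideal_sum => // i _.
    rewrite nth_mkseq // (bigD1 i) //= [c i * _]mulrC mulrACA.
    by case: iQ => _ _; apply; have [] := hc i.
  suff : ~ colon Q (y n) (\prod_i c i) by move=> /(_ h1).
  apply: (big_ind (fun z => ~ colon Q (y n) z)) => [|a b ha hb hab|i _]; last by have [] := hc i.
    by rewrite /colon /= mul1r; case: (my n).
  by apply: ha; apply: (mx_prime _ a b).
exists [seq x <- s | `[< ~ Q x >]]; split.
  by move=> x; rewrite mem_filter => /andP[/asboolP].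
move=> x /max_ex[y my xy]; have [z zs [mz zy]] := hs y my.
exists z; first by rewrite mem_filter zs andbT; apply/asboolP; case: mz.
apply: subset_trans xy _; case: mz => _; apply=> //; by case: my.
Qed.

End Avoidance.

Lemma ideal_scale (k : fieldType) (R : comAlgType k) (Q : set R) (c : k) x :
  is_ideal Q -> Q x -> Q (c *: x).
Proof. by case=> _ _ QM Qx; rewrite -[x]mul1r scalerAl; apply: QM. Qed.

(* On the moment curve (1, t, t^2, ...) any m points are linearly independent,
   so each of the finitely many ideals excludes only finitely many t. *)
Lemma generic_nonzerodivisor (k : fieldType) (R : comAlgType k) (Q : set R) m (f : 'I_m -> R) :
  infinite_set [set: k] -> noeth R -> is_ideal Q ->
  (forall x : R, (forall i, Q (f i * x)) -> Q x) ->
  exists t : 'I_m -> k, forall x : R, Q ((\sum_i t i *: f i) * x) -> Q x.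
Proof.
move=> kinf hR iQ hf; have [s [nQs hs]] := zero_divisors_cover hR iQ.
pose F (t : k) := \sum_(i < m) t ^+ i *: f i.
pose bad (y : R) : set k := [set t | Q (F t * y)].
have fin y : y \in s -> finite_set (bad y).
  move=> ys; apply: contrapT => inf; apply: (nQs _ ys); apply: hf => l.
  have [T hT cT] := @infinite_set_fset _ (bad y) m inf.
  pose a : 'rV[k]_m := \row_j nth 0 (finmap.enum_fset T) j.
  have lt_sz (j : 'I_m) : (j < size (finmap.enum_fset T))%N by apply: leq_trans (ltn_ord j) _.
  have aT j : bad y (a 0 j) by apply: hT; rewrite mxE /=; apply: mem_nth.
  have ua : Vandermonde m a \in unitmx.
    rewrite unitmxE det_Vandermonde unitfE; apply/prodf_neq0 => i _.
    apply/prodf_neq0 => j lt_ij; rewrite subr_eq0 !mxE nth_uniq ?finmap.fset_uniq //.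
    by rewrite neq_ltn lt_ij orbT.
  (* The inverse Vandermonde matrix recovers each [f l * y] from the values [F t * y] at [m] bad
     parameters. *)
  have -> : f l * y = \sum_j (invmx (Vandermonde m a)) j l *: (F (a 0 j) * y).
    pose V := Vandermonde m a.
    under eq_bigr => j _ do rewrite /F mulr_suml scaler_sumr.
    rewrite exchange_big /= (bigD1 l) //= [X in _ + X]big1 ?addr0 => [|i nil].
      under eq_bigr => j _ do rewrite -scalerAl scalerA.
      rewrite -scaler_suml (_ : \sum_j _ = (V *m invmx V) l l).
        by rewrite mulmxV // mxE eqxx scale1r.
      by rewrite mxE; apply: eq_bigr => j _; rewrite [V l j]mxE mulrC.
    under eq_bigr => j _ do rewrite -scalerAl scalerA.
    rewrite -scaler_suml (_ : \sum_j _ = (V *m invmx V) i l).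
      by rewrite mulmxV // mxE (negPf nil) scale0r.
    by rewrite mxE; apply: eq_bigr => j _; rewrite [V i j]mxE mulrC.
  by apply: ideal_sum => // j _; apply: ideal_scale => //; apply: aT.
have finU : finite_set (\bigcup_(y in [set` s]) bad y).
  by apply: bigcup_finite => // y /fin.
have [t ht] : exists t : k, ~ (\bigcup_(y in [set` s]) bad y) t.
  apply: contrapT => h; apply: kinf; apply: sub_finite_set finU => t _.
  by apply: contrapT => ht; apply: h; exists t.
exists (fun i => t ^+ i) => x Qx; apply: contrapT => /hs[y ys hy].
by apply: ht; exists y => //; apply: hy.
Qed.

Lemma ord_missed r n (f : 'I_r -> 'I_n) : (r < n)%N -> exists i, forall s, f s <> i.
Proof.
move=> lt_rn; apply: contrapT => hn.
have /choice[h hh] : forall i, exists s, f s = i.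
  by move=> i; apply: contrapT => hi; apply: hn; exists i => s e; apply: hi; exists s.
have := @leq_card _ _ h (can_inj hh); by rewrite !card_ord leqNgt lt_rn.
Qed.

(* McCoy: descending induction on the size r of the minors; a cofactor
   expansion of an (r+1)-minor turns r-minors into a kernel vector. *)
Lemma mccoy (A : comNzRingType) (Q : set A) n m (phi : 'M[A]_(n, m)) x :
  is_ideal Q ->
  (forall y : 'rV_n, (forall j, Q ((y *m phi) 0 j)) -> forall i, Q (y 0 i)) ->
  (forall g : 'I_n -> 'I_m, Q (x * \det (mxsub id g phi))) -> Q x.
Proof.
move=> iQ inj hx.
suff H d r (f : 'I_r -> 'I_n) (g : 'I_r -> 'I_m) : (r + d)%N = n ->
    Q (x * \det (mxsub f g phi)).
  have f0 : 'I_0 -> 'I_n by case.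
  have g0 : 'I_0 -> 'I_m by case.
  by have := H n 0%N f0 g0 (add0n n); rewrite det_mx00 mulr1.
elim: d r f g => [|d IH] r f g e.
  move: f g; rewrite addn0 in e; subst r => f g.
  have -> : mxsub f g phi = mxsub f id 1%:M *m mxsub id g phi.
    by rewrite -mxsub_mul mul1mx.
  by rewrite det_mulmx mulrCA; case: iQ => _ _; apply.
(* Border the minor by a row [i] outside the image of [f] and by any column [j]. The cofactors along
   the new column do not involve [j], so one vector [y] serves all [j], and its entry at [i] is [x]
   times the original minor. *)
have [|i hi] := ord_missed f; first by rewrite -e -addSnnS ltnS leq_addr.
pose f' (s : 'I_r.+1) := if unlift ord0 s is Some s' then f s' else i.
pose C j := mxsub f' (fun s : 'I_r.+1 => if unlift ord0 s is Some s' then g s' else j) phi.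
pose cf (s : 'I_r.+1) : A := (-1) ^+ s * \det (mxsub (f' \o lift s) g phi).
have cfE j s : cofactor (C j) s ord0 = cf s.
  rewrite /cofactor /cf addn0; congr (_ * \det _); apply/matrixP => a b.
  by rewrite !mxE liftK.
pose y : 'rV_n := \row_a \sum_(s | f' s == a) x * cf s.
have yphi j : (y *m phi) 0 j = x * \det (C j).
  rewrite mxE (expand_det_col _ ord0) mulr_sumr (partition_big f' predT) //=.
  apply: eq_bigr => a _; rewrite mxE mulr_suml; apply: eq_bigr => s /eqP <-.
  by rewrite cfE !mxE unlift_none -mulrA [cf s * _]mulrC.
have : Q (y 0 i) by apply: inj => j; rewrite yphi; apply: IH; rewrite addSnnS.
rewrite mxE (big_pred1 ord0) => [|s].
  rewrite /cf expr0 mul1r (_ : mxsub _ _ _ = mxsub f g phi) //.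
  by apply/matrixP => a b; rewrite !mxE /f' /= liftK.
rewrite /f' /=; case: unliftP => [s' ->|->]; last by rewrite !eqxx.
by rewrite (negPf (introN eqP (hi s'))) eq_sym (negPf (neq_lift _ _)).
Qed.

(** * Krull dimension and growth *)

Section PrimeIdeals.
Variable A : comNzRingType.

Definition is_prime (P : set A) : Prop :=
  [/\ is_ideal P, ~ P 1 & forall a b, P (a * b) -> P a \/ P b].

Lemma prime_idealr_is_prime (p : prime_idealr A) : is_prime [set x | x \in p].
Proof.
split=> [||a b /=]; last by rewrite prime_idealrM => /orP.
  split=> [|x y|a x] /=; [exact: rpred0 | exact: rpredD | exact: idealMr].
by rewrite /= idealr1.
Qed.

Section PrimePred.
Variables (P : set A) (hP : is_prime P).

Definition prime_pred : {pred A} := fun x => `[< P x >].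

Let prime_pred_zmod : zmod_closed prime_pred.
Proof.
case: hP => iP _ _; split=> [|x y /asboolP hx /asboolP hy]; apply/asboolP.
  by case: iP.
exact: idealB.
Qed.

Let prime_pred_proper : 1 \notin prime_pred /\
  forall a, {in prime_pred, forall u, a * u \in prime_pred}.
Proof.
case: hP => -[_ _ PM] P1 _; split=> [|a u /asboolP hu]; first by apply/asboolP.
by apply/asboolP; apply: PM.
Qed.

Let prime_pred_prime : prime_idealr_closed prime_pred.
Proof.
by case: hP => _ _ h u v /asboolP/h[] ?; apply/orP; [left|right]; apply/asboolP.
Qed.

HB.instance Definition _ := GRing.isZmodClosed.Build A prime_pred prime_pred_zmod.
HB.instance Definition _ := isProperIdeal.Build A prime_pred prime_pred_proper.
HB.instance Definition _ := isPrimeIdealrClosed.Build A prime_pred prime_pred_prime.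

Definition prime_of : prime_idealr A := prime_pred.

Lemma prime_ofE : [set x | x \in prime_of] = P.
Proof. by apply/seteqP; split=> x /asboolP. Qed.

End PrimePred.

(** The inclusion of [P] in the next prime is strict because [x] lies in every prime of the given
    chain. *)
Lemma prime_chain_cons S P x n : is_prime P -> S `<=` P -> ~ P x ->
  prime_chain [set y | exists q z, P q /\ y = q + x * z] n ->
  prime_chain S n.+1.
Proof.
move=> hP SP nPx [p [hp pmono]].
have Pp t : P `<=` [set y | y \in p t].
  by move=> y Py; apply: hp; exists y, 0; rewrite mulr0 addr0.
have xp t : x \in p t.
  by apply: hp; exists 0, 1; rewrite mulr1 add0r; case: hP => -[].
exists (fun t => if unlift ord0 t is Some t' then p t' else prime_of hP); split.
  move=> t; case: unliftP => [t' _|_]; last by rewrite prime_ofE.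
  by apply: subset_trans (Pp t').
move=> s t; case: (unliftP ord0 t) => [t' ->|->]; last by rewrite ltn0.
case: (unliftP ord0 s) => [s' ->|-> _].
  by rewrite ltnS => /pmono.
rewrite prime_ofE; split=> [|h]; first exact: Pp.
by apply: nPx; apply: h; apply: xp.
Qed.

Lemma prime_chain_seq (S : set A) n : prime_chain S n ->
  exists P : nat -> set A, (forall i, (i <= n)%N -> is_prime (P i)) /\
    forall i, (i < n)%N -> P i `<` P i.+1.
Proof.
case=> p [_ pmono]; exists (fun i => [set x | x \in p (inord i)]); split.
  by move=> i _; apply: prime_idealr_is_prime.
by move=> i lti; apply: pmono; rewrite !inordK // ltnS ltnW.
Qed.

Lemma prime_chain_sub (S S' : set A) n : S `<=` S' -> prime_chain S' n -> prime_chain S n.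
Proof.
by move=> SS' [p [hp pm]]; exists p; split=> // t; apply: subset_trans (hp t).
Qed.

End PrimeIdeals.

Section Growth.
Variables (k : fieldType) (R : comAlgType k) (gr : nat -> set R).
Hypothesis hgr : standard_graded gr.

Local Notation hc := (hc hgr).

Definition bounded (N : nat) (x : R) : Prop :=
  forall t : nat, (N < t)%N -> hc t x = 0.

Definition trunc (N : nat) (x : R) : R := \sum_(t < N.+1) hc t x.

Definition graded (Q : set R) : Prop := forall j x, Q x -> Q (hc j x).

(** Bounds by [h] the dimension of the image in R/Q of the elements of degree at most [N], without
    forming the quotient; the spanning elements may have any degree. *)
Definition span_mod (Q : set R) (N h : nat) : Prop :=
  exists b : 'I_h -> R, forall y, bounded N y ->
    exists c : 'I_h -> k, Q (y - \sum_i c i *: b i).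

(* [growth Q c] says that dim (R/Q)_{<=N} is O(N^(c-1)); for [c = 0], that R/Q = 0. *)
Definition growth (Q : set R) (c : nat) : Prop :=
  if c is c'.+1 then exists C, forall N, exists2 h, (h <= C * N.+1 ^ c')%N & span_mod Q N h
  else Q 1.

Definition adjoin (Q : set R) (x : R) : set R :=
  [set y | exists q z, Q q /\ y = q + x * z].

Lemma bounded_ex x : exists N, bounded N x.
Proof.
have [n hn] := hc_decomp hgr x; exists n => t ltnt.
rewrite {1}(hn n (leqnn n)) (hc_sum hgr) big1 // => i _.
rewrite (@hc_homog _ _ _ hgr _ i); last exact: hc_grz.
by rewrite eqz_nat [_ == t]ltn_eqF // (ltn_trans (ltn_ord i)).
Qed.

Lemma bounded_mono N M x : (N <= M)%N -> bounded N x -> bounded M x.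
Proof. by move=> le h t /(leq_ltn_trans le); apply: h. Qed.

Lemma trunc_bounded N x : bounded N (trunc N x).
Proof.
move=> t lt; rewrite hc_sum big1 // => i _.
rewrite (@hc_homog _ _ _ hgr _ i); last exact: hc_grz.
by rewrite eqz_nat [_ == t]ltn_eqF // (leq_trans (ltn_ord i)).
Qed.

Lemma hc_trunc N (t : nat) x : hc t (trunc N x) = if (t <= N)%N then hc t x else 0.
Proof.
case: (leqP t N) => [le|lt]; last by rewrite trunc_bounded.
rewrite hc_sum; rewrite -ltnS in le; rewrite (bigD1 (Ordinal le)) //= big1 ?addr0.
  by rewrite hc_id //; apply: hc_grz.
move=> i nei; rewrite (@hc_homog _ _ _ hgr _ i); last exact: hc_grz.
by rewrite eqz_nat; move: nei; rewrite -val_eqE /= => /negPf ->.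
Qed.

Lemma hc_inj_nat x y : (forall t : nat, hc t x = hc t y) -> x = y.
Proof. by move=> h; apply: (@hc_inj _ _ _ hgr) => -[t|t] //; apply: h. Qed.

Lemma trunc_id N x : bounded N x -> trunc N x = x.
Proof.
move=> hx; apply: hc_inj_nat => t; rewrite hc_trunc.
by case: leqP => // /hx ->.
Qed.

Lemma truncB N x y : trunc N (x - y) = trunc N x - trunc N y.
Proof. by rewrite /trunc -sumrB; apply: eq_bigr => i _; rewrite hcB. Qed.

Lemma truncD N x y : trunc N (x + y) = trunc N x + trunc N y.
Proof. by rewrite /trunc -big_split; apply: eq_bigr => i _; rewrite hcD. Qed.

Lemma truncZ N c x : trunc N (c *: x) = c *: trunc N x.
Proof. by rewrite /trunc scaler_sumr; apply: eq_bigr => i _; rewrite hcZ. Qed.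

Lemma trunc_sum N (T : Type) (r : seq T) (F : T -> R) :
  trunc N (\sum_(i <- r) F i) = \sum_(i <- r) trunc N (F i).
Proof.
rewrite /trunc exchange_big; apply: eq_bigr => i _; exact: hc_sum.
Qed.

Lemma truncM N s x z : gr s x ->
  trunc N (x * z) = if (s <= N)%N then x * trunc (N - s) z else 0.
Proof.
move=> hx; apply: hc_inj_nat => t; rewrite hc_trunc (@hcMl _ _ _ hgr s) //.
have [le_sN|lt_Ns] := leqP s N; last first.
  rewrite hc0; case: leqP => // le_tN.
  have : (t%:Z - s%:Z < 0)%R by rewrite subr_lt0 ltz_nat (leq_ltn_trans le_tN).
  by case: (t%:Z - s%:Z) => // n _; rewrite mulr0.
rewrite (@hcMl _ _ _ hgr s) //; have [le_st|lt_ts] := leqP s t.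
  rewrite subzn // hc_trunc leq_sub2rE //.
  by case: ifP => //; rewrite mulr0.
have : (t%:Z - s%:Z < 0)%R by rewrite subr_lt0 ltz_nat.
by case: (t%:Z - s%:Z) => // n _; rewrite /= mulr0 if_same.
Qed.

Lemma graded_trunc Q N x : is_ideal Q -> graded Q -> Q x -> Q (trunc N x).
Proof. by move=> iQ gQ Qx; apply: ideal_sum => // i _; apply: gQ. Qed.

Lemma adjoin_ideal Q x : is_ideal Q -> is_ideal (adjoin Q x).
Proof.
case=> Q0 QD QM; split=> [|_ _ [q [z [hq ->]]] [q' [z' [hq' ->]]]|a _ [q [z [hq ->]]]].
- by exists 0, 0; rewrite mulr0 addr0.
- by exists (q + q'), (z + z'); rewrite mulrDr addrACA; split=> //; apply: QD.
- by exists (a * q), (a * z); rewrite mulrDr [a * (x * _)]mulrCA; split=> //; apply: QM.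
Qed.

Lemma adjoin_graded Q x s : is_ideal Q -> graded Q -> gr s x -> graded (adjoin Q x).
Proof.
move=> iQ gQ hx j _ [q [z [hq ->]]]; exists (hc j q), (hc (j - s%:Z) z).
by rewrite hcD (@hcMl _ _ _ hgr s) //; split=> //; apply: gQ.
Qed.

Lemma colon_graded Q x s : graded Q -> gr s x -> graded (colon Q x).
Proof.
move=> gQ hx j a; rewrite /colon /= => /(gQ (j + s%:Z)).
by rewrite (@hcMr _ _ _ hgr s) // addrK.
Qed.

(** This is the count from the exact sequence 0 -> R/(Q : x)(-s) -> R/Q -> R/(Q + xR) -> 0. The
    second bound is conditional because multiples of [x] have no part of degree at most [N] when
    [N < s]. *)
Lemma span_mod_adjoin Q x s N h1 h2 : is_ideal Q -> graded Q -> gr s x ->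
  span_mod (adjoin Q x) N h1 -> ((s <= N)%N -> span_mod (colon Q x) (N - s) h2) ->
  span_mod Q N (h1 + h2).
Proof.
move=> iQ gQ hx [b1 hb1] hb.
have [b2 hb2] : exists b2 : 'I_h2 -> R, forall y, (s <= N)%N -> bounded (N - s) y ->
    exists c : 'I_h2 -> k, colon Q x (y - \sum_i c i *: b2 i).
  have [/hb[b2 hb2]|lt] := leqP s N; first by exists b2 => y _; apply: hb2.
  by exists (fun=> 0).
exists (fun i => match fintype.split i with inl i1 => trunc N (b1 i1) | inr i2 => x * b2 i2 end).
move=> y hy; have [c1 [q [z [hq ez]]]] := hb1 y hy.
(* Truncation fixes [y] and, as [Q] is graded, keeps [q] in [Q]; the multiple of [x] becomes [x]
   times an element of degree at most [N - s]. *)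
have {}ez : y - \sum_i c1 i *: trunc N (b1 i) = trunc N q + trunc N (x * z).
  rewrite -truncD -ez truncB trunc_id // trunc_sum.
  by congr (_ - _); apply: eq_bigr => i _; rewrite truncZ.
have [c2 hc2] : exists c2 : 'I_h2 -> k, Q (trunc N (x * z) - \sum_i c2 i *: (x * b2 i)).
  rewrite (truncM _ _ hx); case: leqP => [le|lt].
    have [c2] := hb2 _ le (@trunc_bounded (N - s) z); rewrite /colon /= => hc2.
    exists c2; rewrite [X in Q X](_ : _ = (trunc (N - s) z - \sum_i c2 i *: b2 i) * x) //.
    rewrite mulrBl mulrC; congr (_ - _); rewrite mulr_suml; apply: eq_bigr => i _.
    by rewrite -scalerAl mulrC.
  exists (fun=> 0); rewrite big1 ?subr0; first by case: iQ.
  by move=> i _; rewrite scale0r.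
exists (fun i => match fintype.split i with inl i1 => c1 i1 | inr i2 => c2 i2 end).
rewrite big_split_ord /= opprD addrA.
under eq_bigr => i _ do rewrite (unsplitK (inl i)).
under [X in _ - X]eq_bigr => i _ do rewrite (unsplitK (inr i)).
rewrite ez -addrA; case: (iQ) => _ QD _; apply: QD => //.
exact: graded_trunc.
Qed.

Let leq_expl m n e : (m <= n)%N -> (m ^ e <= n ^ e)%N.
Proof. by case: e => [|e] h; rewrite ?expn0 ?leq_exp2r. Qed.

(** Since [colon Q x] contains [Q] and [x] has positive degree, a spanning set of R/Q at level [M]
    also serves for the colon term at level [M + 1]. Each of the [N + 1] levels thus costs O(N^c),
    which raises the exponent by one. *)
Lemma growth_adjoin Q x s c : is_ideal Q -> graded Q -> gr s.+1 x ->
  growth (adjoin Q x) c.+1 -> growth Q c.+2.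
Proof.
move=> iQ gQ hx [C hC]; exists C => N.
have H M : exists2 h, (h <= M.+1 * (C * N.+1 ^ c))%N & (M <= N)%N -> span_mod Q M h.
  elim: M => [|M [h le_h hM]].
    have [h le_h sh] := hC 0%N; exists h.
      by rewrite mul1n (leq_trans le_h) // exp1n muln1 leq_pmulr // expn_gt0.
    move=> _; rewrite -[h]addn0; apply: (span_mod_adjoin iQ gQ hx sh) => //.
  have [h' le_h' sh'] := hC M.+1; case: (leqP M.+1 N) => [le_MN|lt]; last by exists 0%N.
  exists (h' + h)%N.
    rewrite [in leqRHS]mulSn leq_add //; apply: leq_trans le_h' _.
    by rewrite leq_mul2l leq_expl ?orbT.
  move=> _; apply: (span_mod_adjoin iQ gQ hx sh') => _.
  have [b hb] := hM (ltnW le_MN); exists b => y hy.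
  have [|d hd] := hb y; first by apply: bounded_mono hy; rewrite subSS leq_subr.
  by exists d; apply: ideal_mulr.
have [h le_h hN] := H N; exists h; last exact: hN.
by apply: leq_trans le_h _; rewrite expnS mulnCA.
Qed.

Lemma growth_add Q x s c : is_ideal Q -> graded Q -> gr s x ->
  growth (adjoin Q x) c.+1 -> growth (colon Q x) c.+1 -> growth Q c.+1.
Proof.
move=> iQ gQ hx [C1 h1] [C2 h2]; exists (C1 + C2)%N => N.
have [n1 le1 s1] := h1 N; have [n2 le2 s2] := h2 (N - s)%N.
exists (n1 + n2)%N; last exact: span_mod_adjoin s1 (fun=> s2).
rewrite mulnDl leq_add // (leq_trans le2) // leq_mul2l.
by rewrite leq_expl ?orbT // ltnS leq_subr.
Qed.
(** [j] is the highest degree in which [x] has a component outside [P], the degree of its leading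
    form modulo [P]. *)
Lemma not_homog_sum (P : set R) x : is_ideal P -> ~ P x ->
  exists2 j : nat, ~ P (hc j x) & P (x - trunc j x).
Proof.
move=> iP nPx; have [n hn] := hc_decomp hgr x.
have ex : exists j, `[< ~ P (hc j%:Z x) >].
  apply: contrapT => h; apply: nPx; rewrite (hn n) //; apply: ideal_sum => // i _.
  by apply: contrapT => hi; apply: h; exists i; apply/asboolP.
have bd j : `[< ~ P (hc j%:Z x) >] -> (j <= n)%N.
  move=> /asboolP hj; rewrite leqNgt; apply/negP => lt; apply: hj.
  have [N hN] := hc_decomp hgr x; rewrite (_ : hc j x = 0); first by case: iP.
  rewrite {1}(hn n) // hc_sum big1 // => i _; rewrite (@hc_homog _ _ _ hgr _ i); last exact: hc_grz.
  by rewrite eqz_nat [_ == j]ltn_eqF // (ltn_trans (ltn_ord i)).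
case: (ex_maxnP ex bd) => j /asboolP hj jmax; exists j => //.
have le : (j.+1 <= maxn n j.+1)%N by rewrite leq_maxr.
rewrite {1}(hn (maxn n j.+1)) ?leq_maxl // -(big_mkord xpredT (fun t => hc t%:Z x)).
rewrite (big_cat_nat _ le) //= big_mkord /trunc addrAC subrr add0r big_nat_cond.
apply: ideal_sum => // i; rewrite andbT => /andP[lt _]; apply: contrapT => hi.
have /jmax : `[< ~ P (hc i%:Z x) >] by apply/asboolP.
by rewrite leqNgt lt.
Qed.

(** Two elements outside [P] have leading forms outside [P], and the product of these forms is the
    component of top degree of the product modulo [P]. *)
Lemma graded_prime (P : set R) : is_ideal P -> graded P -> ~ P 1 ->
  (forall i j a b, gr i a -> gr j b -> P (a * b) -> P a \/ P b) -> is_prime P.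
Proof.
move=> iP gP nP1 hP; split=> // a b Pab; apply: contrapT => /not_orP[nPa nPb].
have [i nPi Pi] := not_homog_sum iP nPa; have [j nPj Pj] := not_homog_sum iP nPb.
have P' : P (trunc i a * trunc j b).
  have -> : trunc i a * trunc j b = a * b - ((a - trunc i a) * b + trunc i a * (b - trunc j b)).
    by rewrite mulrBl mulrBr addrA subrK opprB addrCA subrr addr0.
  apply: idealB => //; case: (iP) => _ PD PM; apply: PD; last exact: PM.
  exact: ideal_mulr.
have := gP (i + j)%N%:Z _ P'; rewrite {1}/trunc mulr_suml hc_sum (bigD1 ord_max) //=.
rewrite big1 ?addr0 => [|t net].
  rewrite (@hcMl _ _ _ hgr i); last exact: hc_grz.
  rewrite PoszD addrAC subrr add0r hc_trunc leqnn => /(hP i j).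
  by case=> //; [exact: (hc_grz hgr i%:Z) | exact: (hc_grz hgr j%:Z)].
(* A summand with [t < i] would need a component of [trunc j b] in a degree above [j]. *)
rewrite (@hcMl _ _ _ hgr t); last exact: hc_grz.
have lt : (t < i)%N by rewrite ltn_neqAle -ltnS ltn_ord andbT; move: net; rewrite -val_eqE.
rewrite subzn ?(leq_trans (ltnW lt)) ?leq_addr // hc_trunc.
by rewrite leqNgt ltn_subRL ltn_add2r lt mulr0.
Qed.

Lemma adjoin_proper (P : set R) s x : graded P -> ~ P 1 -> gr s.+1 x -> ~ adjoin P x 1.
Proof.
move=> gP nP1 hx [q [z [Pq e1]]]; apply: nP1.
have : hc 0 (1 : R) = hc 0 q.
  by rewrite e1 hcD (@hcMl _ _ _ hgr s.+1) // sub0r [hc (- _) _]/(0 : R) mulr0 addr0.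
rewrite hc_id; last by rewrite -[1]scale1r; apply: gr_scalar.
by move=> ->; apply: gP.
Qed.

(* A graded ideal maximal among those with large growth is prime, and killing a
   homogeneous element of positive degree lowers the growth by at most one. *)
Lemma growth_prime_chain c (Q : set R) : noeth R -> is_ideal Q -> graded Q -> ~ growth Q c ->
  prime_chain Q c.
Proof.
move=> hR; elim: c Q => [|c IH] Q iQ gQ nG.
  (* A proper graded ideal consists of elements of residue 0, since a nonzero component of degree 0
     would be a unit in it. *)
  pose m : set R := [set x | residue gr x = 0].
  have pm : is_prime m.
    split=> [||a b]; rewrite /m /=.
    - split=> [|x y|a x] /=; rewrite ?(residue0 hgr) // ?(residueD hgr) ?(residueM hgr).
        by move=> -> ->; rewrite addr0.
      by move=> ->; rewrite mulr0.
    - by rewrite (residue1 hgr) => /eqP; rewrite oner_eq0.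
    - by rewrite (residueM hgr) => /eqP; rewrite mulf_eq0 => /orP[]/eqP; [left|right].
  exists (fun=> prime_of pm); split=> [_|s t]; last by rewrite (ord1 s) (ord1 t).
  rewrite prime_ofE => x Qx; rewrite /m /=; apply: contrapT => /eqP nz; apply: nG => /=.
  have := gQ 0 _ Qx; rewrite hc_residue => /(ideal_scale (residue gr x)^-1 iQ).
  by rewrite scalerA mulVf // scale1r.
pose F : set (set R) := [set P | [/\ is_ideal P, graded P & ~ growth P c.+1]].
have [|//|P [[iP gP nGP] QP Pmax]] := @noeth_max R hR F Q; first by move=> P [].
have big1 P' : is_ideal P' -> growth P' c.+1 \/ ~ P' 1.
  move=> iP'; have [P'1|] := pselect (P' 1); [left | by right].
  exists 0%N => N; exists 0%N => //; exists (fun=> 0) => y _; exists (fun=> 0).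
  by rewrite -[X in P' X]mulr1; case: iP' => _ _; apply.
have pP : is_prime P.
  apply: graded_prime => //; first by case: (big1 P iP).
  move=> i j a b ha hb Pab; apply: contrapT => /not_orP[nPa nPb]; apply: nGP.
  apply: (growth_add iP gP ha).
    apply: contrapT => nG'; apply: nPa; apply: (Pmax (adjoin P a)).
    - by split=> //; [apply: adjoin_ideal | apply: adjoin_graded ha].
    - by move=> y Py; exists y, 0; rewrite mulr0 addr0.
    - by exists 0, 1; rewrite mulr1 add0r; split=> //; case: iP.
  apply: contrapT => nG'; apply: nPb; apply: (Pmax (colon P a)).
  - by split=> //; [apply: colon_ideal | apply: colon_graded ha].
  - by move=> y Py; apply: ideal_mulr.
  - by rewrite /colon /= mulrC.
(* If [P] contained everything of positive degree, R/P would be spanned by 1 and its growth would be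
   bounded. *)
have [s [x hx nPx]] : exists s, exists2 x, gr s.+1 x & ~ P x.
  apply: contrapT => h; apply: nGP; exists 1%N => N; exists 1%N; first by rewrite mul1n expn_gt0.
  exists (fun=> 1) => y _; exists (fun=> residue gr y).
  rewrite big_ord1 -hc_residue.
  have [n hn] := hc_decomp hgr y; rewrite {1}(hn n.+1) // big_ord_recl addrAC subrr add0r.
  apply: ideal_sum => // i _; apply: contrapT => hi; apply: h; exists i.
  by exists (hc (lift ord0 i) y) => //; apply: (hc_grz hgr (lift ord0 i)%:Z).
apply: (prime_chain_cons pP QP nPx); apply: IH.
- exact: adjoin_ideal.
- exact: adjoin_graded hx.
(* For [c = 0] small growth of the new ideal means that it contains 1; for larger [c] it would make
   the growth of [P] small. *)
case: c nG F nGP Pmax big1 => [|c] _ _ nGP _ _; last by move=> /(growth_adjoin iP gP hx).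
by apply: adjoin_proper hx; case: pP.
Qed.

(** * Growth forced by chains of primes *)

Definition indep (Q : set R) (T : finType) (b : T -> R) : Prop :=
  forall c : T -> k, Q (\sum_t c t *: b t) -> forall t, c t = 0.

(** In a relation consider the lowest exponent [a] of [x]: [x ^+ a] cancels modulo [P], and since
    [x] lies in [P'] what is left says that [L a] vanishes modulo [P']. *)
Lemma indep_powers (P P' : set R) x (T : finType) (b : T -> R) N :
  is_prime P -> is_ideal P' -> P `<=` P' -> P' x -> ~ P x -> indep P' b ->
  indep P (fun at_ : 'I_N * T => x ^+ at_.1 * b at_.2).
Proof.
move=> pP iP' PP' P'x nPx hb c hc_.
pose L a := \sum_t c (a, t) *: b t.
have hL : P (\sum_(a < N) x ^+ a * L a).
  move: hc_; rewrite (_ : \sum_t _ = \sum_(a < N) x ^+ a * L a) //.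
  under [RHS]eq_bigr => a _ do rewrite mulr_sumr.
  by rewrite pair_bigA; apply: eq_bigr => -[a t] _; rewrite scalerAr.
suff H (n : nat) (a : 'I_N) : a = n :> nat -> forall t, c (a, t) = 0.
  by case=> a t; apply: (H a a).
elim/ltn_ind: n a => n IH a ea.
apply: (hb (fun t => c (a, t))); rewrite -/(L a).
have L0 (a' : 'I_N) : (a' < a)%N -> L a' = 0.
  move=> lt; rewrite /L big1 // => t _; rewrite (IH a') ?scale0r //.
  by rewrite -ea.
pose W := \sum_(a' < N | (a < a')%N) x ^+ (a' - a.+1) * L a'.
have e : \sum_(a < N) x ^+ a * L a = x ^+ a * (L a + x * W).
  rewrite (bigD1 a) //= mulrDr; congr (_ + _).
  rewrite mulrA -exprSr /W mulr_sumr big_mkcond [RHS]big_mkcond /=.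
  apply: eq_bigr => a' _; case: (ltngtP a a') => [lt|lt|/val_inj ->]; last by rewrite eqxx.
    rewrite mulrA -exprD subnKC // ifT //.
    by apply/eqP => ee; rewrite ee ltnn in lt.
  by rewrite L0 // mulr0 if_same.
have nPxa m : ~ P (x ^+ m).
  elim: m => [|m IHm]; first by case: pP.
  by rewrite exprS; case: pP => _ _ hp /hp[].
have PL : P (L a + x * W).
  by move: hL; rewrite e; case: pP => _ _ hp /hp[] // /nPxa.
rewrite -[L a](addrK (x * W)); apply: idealB => //; first exact: PP'.
exact: ideal_mulr.
Qed.

Lemma indep_span_mod (T : finType) (b : T -> R) (Q : set R) N h :
  is_ideal Q -> indep Q b -> (forall t, bounded N (b t)) -> span_mod Q N h -> (#|T| <= h)%N.
Proof.
move=> iQ ib bb [e he]; rewrite leqNgt; apply/negP => lt.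
have /choice[c hc_] : forall t, exists c : 'I_h -> k, Q (b t - \sum_i c i *: e i).
  by move=> t; apply: he.
pose M : 'M[k]_(#|T|, h) := \matrix_(a, i) c (enum_val a) i.
have : kermx M != 0.
  rewrite -mxrank_eq0 mxrank_ker subn_eq0 -ltnNge.
  exact: leq_ltn_trans (rank_leq_col M) lt.
case/rowV0Pn => u /sub_kermxP uM; apply/negP; rewrite negbK; apply/eqP/rowP => a.
rewrite mxE -[a]enum_valK; apply: (ib (fun t => u 0 (enum_rank t))).
rewrite (_ : \sum_t _ = \sum_t u 0 (enum_rank t) *: (b t - \sum_i c t i *: e i)).
  by apply: ideal_sum => // t _; apply: ideal_scale.
under [RHS]eq_bigr => t _ do rewrite scalerBr scaler_sumr.
rewrite sumrB exchange_big /= [X in _ - X]big1 ?subr0 // => i _.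
under eq_bigr => t _ do rewrite scalerA.
rewrite -scaler_suml (_ : \sum_t _ = (u *m M) 0 i); first by rewrite uM mxE scale0r.
rewrite mxE (reindex enum_rank) /=; last by exists enum_val => ? _; rewrite ?enum_rankK ?enum_valK.
by apply: eq_bigr => t _; rewrite mxE enum_rankK.
Qed.

Lemma boundedM N M x y : bounded N x -> bounded M y -> bounded (N + M) (x * y).
Proof.
move=> hx hy t lt; rewrite -(trunc_id hx) /trunc mulr_suml hc_sum big1 // => i _.
rewrite (@hcMl _ _ _ hgr i); last exact: hc_grz.
have le : (i <= N)%N by rewrite -ltnS.
rewrite subzn; last by rewrite ltnW // (leq_ltn_trans _ lt) // (leq_trans le) ?leq_addr.
by rewrite hy ?mulr0 // ltn_subRL (leq_ltn_trans _ lt) // leq_add2r.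
Qed.

Lemma bounded1 : bounded 0 1.
Proof.
move=> t lt; rewrite (@hc_homog _ _ _ hgr _ 0%Z); last first.
  by rewrite -[1]scale1r; apply: gr_scalar.
by rewrite eqz_nat ltn_eqF.
Qed.

Lemma boundedX N x m : bounded N x -> bounded (m * N) (x ^+ m).
Proof.
by move=> hx; elim: m => [|m IH]; [apply: bounded1 | rewrite exprS mulSn; apply: boundedM].
Qed.

(** Choosing one element in each step of the chain and working down from its largest prime gives
    (N+1)^n monomials with exponents at most [N]. The chosen elements need not be homogeneous; [s]
    bounds their degrees. *)
Lemma prime_chain_indep n : prime_chain [set 0 : R] n -> exists s, forall N,
  exists (T : finType) (b : T -> R),
    [/\ #|T| = (N.+1 ^ n)%N, indep [set 0] b & forall t, bounded (n * (N * s)) (b t)].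
Proof.
move=> /prime_chain_seq[P [pP Plt]].
have /choice[x hx] : forall i : 'I_n, exists x, P i.+1 x /\ ~ P i x.
  move=> i; have [_ h] := Plt i (ltn_ord i); apply: contrapT => hn; apply: h => y Py.
  by apply: contrapT => ny; apply: hn; exists y.
have [s hs] : exists s, forall i, bounded s (x i).
  have /choice[f hf] := fun i => bounded_ex (x i).
  exists (\max_i f i) => i; apply: bounded_mono (hf i); exact: leq_bigmax.
exists s => N.
suff H d : (d <= n)%N -> exists (T : finType) (b : T -> R),
    [/\ #|T| = (N.+1 ^ d)%N, indep (P (n - d)%N) b & forall t, bounded (d * (N * s)) (b t)].
  have [T [b [h1 h2 h3]]] := H n (leqnn n); exists T, b; split=> // c hc_.
  apply: h2; rewrite hc_; by case: (pP (n - n)%N) => //; rewrite ?leq_subr // => -[].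
elim: d => [_|d IH lt].
  exists unit, (fun=> 1); split=> [|c|_]; first by rewrite card_unit.
    rewrite subn0 (big_pred1 tt) => [hc_ []|[]//]; apply: contrapT => /eqP nz.
    have [iP + _] := pP n (leqnn n); apply; rewrite -[1](scalerK nz).
    exact: ideal_scale.
  by rewrite mul0n; apply: bounded1.
have [T [b [h1 h2 h3]]] := IH (ltnW lt).
have lti : (n - d.+1 < n)%N by rewrite ltn_subrL (leq_trans _ lt).
pose y := x (Ordinal lti); have [hy1 hy2] := hx (Ordinal lti).
have e : (n - d.+1).+1 = (n - d)%N by rewrite subnSK.
exists ('I_N.+1 * T)%type, (fun at_ : 'I_N.+1 * T => y ^+ at_.1 * b at_.2); split.
- by rewrite card_prod card_ord h1 expnS.
- apply: (@indep_powers _ (P (n - d)%N)) => //.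
  + by apply: pP; rewrite leq_subr.
  + by have [] := pP (n - d)%N; rewrite ?leq_subr.
  + by rewrite -e; case: (Plt _ lti).
  + by rewrite -e.
- move=> [a t] /=; rewrite mulSn; apply: boundedM => //.
  apply: (@bounded_mono (a * s)); first by rewrite leq_mul2r -ltnS ltn_ord orbT.
  by apply: boundedX; apply: hs.
Qed.

Lemma growth_chain_bound c : growth [set 0] c.+1 -> ~ prime_chain [set 0 : R] c.+1.
Proof.
move=> [C hC] /prime_chain_indep[s hs].
(* [K] makes (c+1)Ns + 1 <= K(N+1), and [N] makes C(K(N+1))^c = N(N+1)^c, which is less than the
   number (N+1)^(c+1) of monomials. *)
pose K := (c.+1 * s).+1.
pose N := (C * K ^ c)%N.
have [T [b [cT ib bb]]] := hs N; have [h le_h sh] := hC (c.+1 * (N * s))%N.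
have i0 : is_ideal [set 0 : R].
  by split=> [|x y -> ->|a x ->] //=; rewrite ?addr0 ?mulr0.
have := indep_span_mod i0 ib bb sh; rewrite cT; apply/negP; rewrite -ltnNge.
apply: leq_ltn_trans le_h _.
apply: (@leq_ltn_trans (C * (K * N.+1) ^ c)%N).
  rewrite leq_mul2l leq_expl ?orbT // [(N * s)%N]mulnC mulnA /K mulSn mulnS addSn ltnS.
  by rewrite addnA leq_addl.
by rewrite expnMn mulnA expnS ltn_mul2r expn_gt0 /= ltnS.
Qed.

(** Small growth of R/(x) would give small growth of [R], which the chain of length [n + 1]
    excludes; so R/(x) has large growth and therefore a long chain. *)
Lemma dim_hypersurface (x : R) s n : noeth R -> gr s.+1 x ->
  prime_chain [set 0 : R] n.+1 -> prime_chain [set y : R | exists z, y = x * z] n.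
Proof.
move=> hR hx ch.
have i0 : is_ideal [set 0 : R].
  by split=> [|y z -> ->|a y ->] //=; rewrite ?addr0 ?mulr0.
have g0 : graded [set 0 : R] by move=> j y ->; rewrite /= hc0.
apply: (@prime_chain_sub _ _ (adjoin [set 0] x)).
  by move=> _ [z ->]; exists 0, z; rewrite add0r.
apply: growth_prime_chain => //; first exact: adjoin_ideal.
  exact: adjoin_graded hx.
case: n ch => [|n] ch; last by move=> /(growth_adjoin i0 g0 hx)/growth_chain_bound.
by apply: adjoin_proper hx => // /eqP; rewrite oner_eq0.
Qed.

End Growth.

(** * Minimal generators and projective dimension *)

Section Lifting.
Variable A : comNzRingType.

Section Image.
Variables (M N : lmodType A) (f : {linear M -> N}).

(** The image becomes a module of its own because [projective] lifts only along surjections; maps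
    are corestricted to it. *)
Definition image_pred : {pred N} := fun y => `[< exists x, f x = y >].

Let image_pred_closed : submod_closed image_pred.
Proof.
split=> [|a _ _ /asboolP[x <-] /asboolP[y <-]]; apply/asboolP.
  by exists 0; rewrite linear0.
by exists (a *: x + y); rewrite linearP.
Qed.

HB.instance Definition _ := GRing.isSubmodClosed.Build A N image_pred
  image_pred_closed.

Record image_mod := ImageMod { image_val : N; _ : image_val \in image_pred }.

HB.instance Definition _ := [isSub for image_val].
HB.instance Definition _ := [Choice of image_mod by <:].
HB.instance Definition _ := [SubChoice_isSubLmodule of image_mod by <:].
End Image.

Lemma linear_ex (M N : lmodType A) (f : M -> N) : linear f ->
  exists g : {linear M -> N}, g =1 f.
Proof.
move=> lf; pose i := GRing.isLinear.Build A M N _ f lf.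
by exists (HB.pack f i : {linear M -> N}).
Qed.

Lemma projective_lift (P M N : lmodType A) (f : {linear M -> N}) (g : P -> N) :
  projective P -> linear g -> (forall x, exists y, f y = g x) ->
  exists h : {linear P -> M}, forall x, f (h x) = g x.
Proof.
move=> hP lg hg.
have fI y : f y \in image_pred f by apply/asboolP; exists y.
have gI y : g y \in image_pred f by apply/asboolP; apply: hg.
have [|f' hf'] := @linear_ex M (image_mod f) (fun y => ImageMod (fI y)).
  by move=> a x y; apply: val_inj; rewrite /= linearP.
have [|g' hg'] := @linear_ex P (image_mod f) (fun y => ImageMod (gI y)).
  by move=> a x y; apply: val_inj; rewrite /= lg.
have [|h hh] := hP _ _ f' g'.
  case=> y yI; case/asboolP: (yI) => x ex; exists x; apply: val_inj.
  by rewrite hf' /= ex.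
by exists h => x; have /(congr1 val) := hh x; rewrite hf' hg'.
Qed.

Lemma projective_rV m : projective 'rV[A]_m.
Proof.
move=> M N f g hf.
have /choice[a ha] : forall i : 'I_m, exists x, f x = g (delta_mx 0 i) by move=> i.
have [|h hh] := @linear_ex 'rV[A]_m M (fun v => \sum_i v 0 i *: a i).
  move=> c u v; rewrite scaler_sumr -big_split; apply: eq_bigr => i _.
  by rewrite !mxE scalerDl scalerA.
exists h => v; rewrite hh linear_sum [in RHS](row_sum_delta v) linear_sum.
by apply: eq_bigr => i _; rewrite !linearZ /= ha.
Qed.

(* Compare the given partial resolution with one of length 2 by lifting in
   both directions, and then build the homotopy as far as [F2]. *)
Lemma pdim2_retraction (M F0 F1 F2 : lmodType A) (e : {linear F0 -> M})
    (d1 : {linear F1 -> F0}) (d2 : {linear F2 -> F1}) :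
  projective F0 -> projective F1 -> projective F2 ->
  (forall y, exists x, e x = y) ->
  (forall x, e x = 0 <-> exists y, x = d1 y) ->
  (forall x, d1 x = 0 <-> exists y, x = d2 y) ->
  pdim_le M 2 ->
  exists h : {linear F2 -> F2}, (forall x, d2 (h x) = 0) /\
    forall x, d2 x = 0 -> h x = x.
Proof.
move=> pF0 pF1 pF2 es ex0 ex1 [P [d [eP [pP P0 ePs exP0 exP]]]].
have lift0 x y : e x = 0 -> d1 y = x -> exists y, d1 y = x by exists y.
have d1d2 x : d1 (d2 x) = 0 by apply/ex1; exists x.
have ed1 x : e (d1 x) = 0 by apply/ex0; exists x.
have eP0 x : eP (d 0%N x) = 0 by apply/exP0; exists x.
have dd i x : d i (d i.+1 x) = 0 by apply/exP; exists x.
have [|y|u0 hu0] := projective_lift (f := eP) (g := e) pF0; [exact: linearP | exact: ePs |].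
have [|y|v0 hv0] := projective_lift (f := e) (g := eP) (pP 0%N); [exact: linearP | exact: es |].
have [|y|u1 hu1] := projective_lift (f := d 0%N) (g := u0 \o d1) pF1; first exact: linearP.
  rewrite /=; have /exP0[x ->] : eP (u0 (d1 y)) = 0; last by exists x.
  by rewrite hu0 ed1.
have [|y|v1 hv1] := projective_lift (f := d1) (g := v0 \o d 0%N) (pP 1%N); first exact: linearP.
  rewrite /=; have /ex0[x ->] : e (v0 (d 0%N y)) = 0; last by exists x.
  by rewrite hv0 eP0.
have [|y|u2 hu2] := projective_lift (f := d 1%N) (g := u1 \o d2) pF2; first exact: linearP.
  rewrite /=; have /exP[x ->] : d 0%N (u1 (d2 y)) = 0; last by exists x.
  by rewrite hu1 /= d1d2 linear0.
have [|y|v2 hv2] := projective_lift (f := d2) (g := v1 \o d 1%N) (pP 2%N); first exact: linearP.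
  rewrite /=; have /ex1[x ->] : d1 (v1 (d 1%N y)) = 0; last by exists x.
  by rewrite hv1 /= dd linear0.
have [|y|h0 hh0] := projective_lift (f := d1) (g := idfun \- (v0 \o u0)) pF0.
- exact: linearP.
- rewrite /=; rewrite /=; have /ex0[x ->] : e (y - v0 (u0 y)) = 0; last by exists x.
  by rewrite linearB /= hv0 hu0 subrr.
have [|y|h1 hh1] := projective_lift (f := d2) (g := idfun \- (v1 \o u1) \- (h0 \o d1)) pF1.
- exact: linearP.
- rewrite /=; have /ex1[x ->] : d1 (y - v1 (u1 y) - h0 (d1 y)) = 0; last by exists x.
  by rewrite !linearB /= hv1 /= hu1 hh0 /= subrr.
(* [h] is the defect of the homotopy at [F2], with values in the kernel of [d2]. On that kernel it
   is the identity minus v2 u2, and u2 vanishes there since [P 3 = 0] makes [d 1] injective. *)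
have [|h hh] := @linear_ex F2 F2 (idfun \- (v2 \o u2) \- (h1 \o d2)).
  exact: linearP.
exists h; split=> x.
  by rewrite hh /= !linearB /= hv2 /= hu2 hh1 /= d1d2 linear0 subr0 subrr.
move=> d2x; rewrite hh /= d2x linear0 subr0.
suff -> : u2 x = 0 by rewrite linear0 subr0.
have /exP[y ->] : d 1%N (u2 x) = 0 by rewrite hu2 /= d2x linear0.
by rewrite (P0 3%N _ y) // linear0.
Qed.

End Lifting.

Section MinimalGenerators.
Variables (k : fieldType) (R : comAlgType k) (gr : nat -> set R).
Hypothesis hgr : standard_graded gr.

Local Notation hc := (hc hgr).
Local Notation residue := (residue gr).

Definition homog_mx p q (e : 'I_p -> int) (d : 'I_q -> int) (B : 'M[R]_(p, q)) : Prop :=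
  forall a b, grz gr (e a - d b) (B a b).

(** The component of degree [j] in the free module whose [b]-th basis vector sits in degree [d b];
    the rows of a [homog_mx] are homogeneous in this sense. *)
Definition hcv q (d : 'I_q -> int) (j : int) (v : 'rV[R]_q) : 'rV[R]_q :=
  \row_b hc (j - d b) (v 0 b).

Lemma hcv_mulmx p q (e : 'I_p -> int) (d : 'I_q -> int) (B : 'M[R]_(p, q)) j w :
  homog_mx e d B -> hcv d j (w *m B) = hcv e j w *m B.
Proof.
move=> hB; apply/rowP => b; rewrite !mxE hc_sum; apply: eq_bigr => a _.
by rewrite (hcMr hgr _ _ (hB a b)) !mxE opprB addrA subrK.
Qed.

Lemma hcv_id q (d : 'I_q -> int) j (v : 'rV[R]_q) :
  (forall b, grz gr (j - d b) (v 0 b)) -> hcv d j v = v.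
Proof. by move=> h; apply/rowP => b; rewrite mxE hc_id. Qed.

Lemma hcv_decomp q (d : 'I_q -> int) (v : 'rV[R]_q) N (J : seq int) : uniq J ->
  (forall b, bounded hgr N (v 0 b)) ->
  (forall b (t : nat), (t <= N)%N -> t%:Z + d b \in J) ->
  v = \sum_(j <- J) hcv d j v.
Proof.
move=> uJ hv hJ; apply/rowP => b; rewrite summxE.
under eq_bigr => j _ do rewrite mxE.
apply: (@hc_inj _ _ _ hgr) => i; rewrite hc_sum.
rewrite (eq_bigr (fun j => if j == i + d b then hc i (v 0 b) else 0)); last first.
  move=> j _; rewrite (@hc_homog _ _ _ hgr _ (j - d b)); last exact: hc_grz.
  by rewrite subr_eq; case: eqP => // ->; rewrite addrK.
rewrite -big_mkcond /=.
have [iJ|niJ] := boolP (i + d b \in J).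
  by rewrite -big_filter filter_pred1_uniq // big_seq1.
rewrite big1_seq; last by move=> j /andP[/eqP -> iJ]; rewrite iJ in niJ.
case: i niJ => // t niJ; apply: hv; rewrite ltnNge; apply/negP => le.
by rewrite hJ in niJ.
Qed.

(** Take the least number of homogeneous generators. A relation with a coefficient of nonzero
    residue has a homogeneous component with a nonzero scalar there, and that generator could be
    dropped. *)
Lemma minimal_generators q (d : 'I_q -> int) (N : set 'rV[R]_q) : noeth R ->
  N 0 -> (forall u v, N u -> N v -> N (u + v)) -> (forall a v, N v -> N (a *: v)) ->
  (forall j v, N v -> N (hcv d j v)) ->
  exists p (B : 'M[R]_(p, q)) (e : 'I_p -> int),
    [/\ homog_mx e d B, forall v, N v <-> exists w, v = w *m B &
      forall w : 'rV[R]_p, w *m B = 0 -> forall a, residue (w 0 a) = 0].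
Proof.
move=> hR N0 ND NZ Nhc.
pose good p := exists (B : 'M[R]_(p, q)) (e : 'I_p -> int),
  homog_mx e d B /\ forall v, N v <-> exists w, v = w *m B.
have Nmul p (B : 'M[R]_(p, q)) w : (forall a, N (row a B)) -> N (w *m B).
  by move=> h; rewrite mulmx_sum_row; apply: big_ind => // a _; apply: NZ.
have ex : exists p, `[< good p >].
  have [p [B [NB hB]]] := noeth_mx hR N0 ND NZ.
  have [n hn] : exists n, forall ab : 'I_p * 'I_q, bounded hgr n (B ab.1 ab.2).
    have /choice[f hf] := fun ab : 'I_p * 'I_q => bounded_ex hgr (B ab.1 ab.2).
    by exists (\max_ab f ab) => ab; apply: bounded_mono (hf ab); apply: leq_bigmax.
  pose J := undup [seq t%:Z + d b | t <- iota 0 n.+1, b <- enum 'I_q].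
  have hJ b (t : nat) : (t <= n)%N -> t%:Z + d b \in J.
    move=> le; rewrite mem_undup; apply/allpairsP; exists (t, b).
    by rewrite mem_iota mem_enum /= ltnS.
  (* The homogeneous components of the rows of [B], indexed by row and degree, generate [N] as
     well. *)
  pose T := ('I_p * 'I_(size J))%type.
  pose dec (a : 'I_#|{: T}|) : T := enum_val a.
  pose C : 'M[R]_(#|{: T}|, q) :=
    \matrix_a hcv d J`_(dec a).2 (row (dec a).1 B).
  exists #|{: T}|; apply/asboolP; exists C, (fun a => J`_(dec a).2); split.
    by move=> a b; rewrite !mxE; apply: hc_grz.
  move=> v; split=> [/hB[w ->]|[w ->]]; last first.
    by apply: Nmul => a; rewrite rowK; apply: Nhc.
  exists (\row_a w 0 (dec a).1); rewrite !mulmx_sum_row.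
  rewrite (reindex (@enum_rank {: T})) /=; last first.
    by exists enum_val => ? _; rewrite ?enum_rankK ?enum_valK.
  under [RHS]eq_bigr => a _ do rewrite mxE rowK /dec enum_rankK.
  rewrite -(pair_bigA _ (fun (i : 'I_p) (s : 'I_(size J)) => w 0 i *: hcv d J`_s (row i B))) /=.
  apply: eq_bigr => i _; rewrite -scaler_sumr; congr (_ *: _).
  have E : row i B = \sum_(j <- J) hcv d j (row i B).
    apply: (@hcv_decomp _ _ _ n) => //; first exact: undup_uniq.
    by move=> b; rewrite mxE; apply: (hn (i, b)).
  by rewrite {1}E (big_nth 0) big_mkord.
case: (ex_minnP ex) => p /asboolP[B [e [hB hN]]] pmin.
exists p, B, e; split=> // w wB a0; apply: contrapT => /eqP nz.
pose w' := hcv e (e a0) w.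
have w'B : w' *m B = 0.
  by rewrite /w' -(hcv_mulmx _ _ hB) wB; apply/rowP => b; rewrite !mxE hc0.
have w'a0 : w' 0 a0 = (residue (w 0 a0))%:A by rewrite mxE subrr hc_residue.
case: p B e hB hN pmin w a0 wB nz w' w'B w'a0 {ex} => [|p] B e hB hN pmin w a0 wB nz w' w'B w'a0.
  by case: a0 nz w'a0.
have : (p.+1 <= p)%N; last by rewrite ltnn.
apply: pmin; apply/asboolP; exists (row' a0 B), (e \o lift a0); split.
  by move=> a b; rewrite mxE; apply: hB.
have rN a : N (row a B) by apply/hN; exists (delta_mx 0 a); rewrite -rowE.
move=> v; split=> [/hN[u ->]|[u ->]]; last first.
  by apply: Nmul => a; rewrite (_ : row _ _ = row (lift a0 a) B) //; apply/rowP => b; rewrite !mxE.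
pose c := (residue (w 0 a0))^-1.
(* Subtracting a multiple of the relation [w'] clears the coefficient of the dropped generator
   [a0]. *)
pose u' := u - (c *: u 0 a0) *: w'.
have u'0 : u' 0 a0 = 0.
  rewrite !mxE -/(w' 0 a0) w'a0 -!scalerAl -scalerAr mulr1 scalerA mulVf // scale1r.
  by rewrite subrr.
exists (col' a0 u'); transitivity (u' *m B).
  by rewrite mulmxBl -scalemxAl w'B scaler0 subr0.
apply/rowP => b; rewrite !mxE (bigD1_ord a0) //= u'0 mul0r add0r.
by apply: eq_bigr => a _; rewrite !mxE.
Qed.

(** * Nakayama's lemma for the filtration by order *)

Definition order_ge (N : nat) (x : R) : Prop := forall t : nat, (t < N)%N -> hc t x = 0.

Lemma order_geM M N x y : order_ge M x -> order_ge N y -> order_ge (M + N) (x * y).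
Proof.
move=> hx hy t lt; have [n hn] := hc_decomp hgr x.
rewrite {1}(hn n) // mulr_suml hc_sum big1 // => i _.
rewrite (@hcMl _ _ _ hgr i); last exact: hc_grz.
have [/hx ->|le] := ltnP i M; first by rewrite mul0r.
have [le_it|lt_ti] := leqP i t.
  rewrite subzn // hy ?mulr0 // ltn_subLR //.
  by rewrite (leq_trans lt) // leq_add2r.
have : (t%:Z - i%:Z < 0)%R by rewrite subr_lt0 ltz_nat.
by case: (t%:Z - i%:Z) => // ? _; rewrite mulr0.
Qed.

Lemma order_ge_sum N (T : Type) (r : seq T) (F : T -> R) :
  (forall i, order_ge N (F i)) -> order_ge N (\sum_(i <- r) F i).
Proof. by move=> h t lt; rewrite hc_sum big1 // => i _; apply: h. Qed.

Lemma order_ge_eq0 x : (forall N, order_ge N x) -> x = 0.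
Proof.
move=> h; apply: (@hc_inj _ _ _ hgr) => -[t|t] //.
by rewrite hc0; apply: (h t.+1).
Qed.

(* [K = ker d] satisfies [K = h K] and [K] lies in [m F], so [K = m^N K] for all [N]. *)
Lemma retraction_nakayama n (K : set 'rV[R]_n) (h : {linear 'rV[R]_n -> 'rV[R]_n}) :
  (forall x, K (h x)) -> (forall x, K x -> h x = x) ->
  (forall x, K x -> forall a, residue (x 0 a) = 0) -> forall x, K x -> x = 0.
Proof.
move=> hK hid hres.
suff H N x : K x -> forall a, order_ge N (x 0 a).
  by move=> x Kx; apply/rowP => a; rewrite mxE; apply: order_ge_eq0 => N; apply: H.
elim: N x => [//|N IH] x Kx b.
(* Expand [h x] over the basis: the coordinates of [x] have order at least 1, and the images of the
   basis vectors lie in [K], so have order at least [N]. *)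
rewrite -(hid x Kx) (row_sum_delta x) linear_sum summxE.
apply: order_ge_sum => a; rewrite linearZ mxE -add1n.
apply: order_geM; last exact: IH.
by case=> // _; rewrite hc_residue hres // scale0r.
Qed.

End MinimalGenerators.

(** * Independence of the Betti numbers from the resolution *)

(** [P] carries the invariant that makes the next step solvable, [Q] the relation between
    consecutive terms; the type varies with the index as the ranks of a resolution do. *)
Lemma dep_choice (T : nat -> Type) (P : forall i, T i -> Prop)
    (Q : forall i, T i -> T i.+1 -> Prop) (x0 : T 0%N) :
  P 0%N x0 -> (forall i x, P i x -> exists y, P i.+1 y /\ Q i x y) ->
  exists s : forall i, T i, [/\ s 0%N = x0, forall i, P i (s i) & forall i, Q i (s i) (s i.+1)].
Proof.
move=> P0 h.
have nx i (x : {x : T i | P i x}) : {y : {y : T i.+1 | P i.+1 y} | Q i (sval x) (sval y)}.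
  apply: cid; case: x => x px; have [y [Py Qy]] := h _ _ px.
  by exists (exist _ y Py).
pose s := fix s i : {x : T i | P i x} :=
  if i is j.+1 then sval (nx j (s j)) else exist _ x0 P0.
exists (fun i => sval (s i)); split=> // i; first exact: svalP.
exact: (svalP (nx i (s i))).
Qed.

(** The kernel of the map from [Z] to Z'/B' induced by [U] lies in [B]. Multiplying by the cokernel
    matrix of [B'] turns membership in [B'] into an equation, so that ranks can be counted. *)
Lemma subquotient_rank (k : fieldType) p q r r' (Z : 'M[k]_p) (B : 'M_(r, p))
    (Z' : 'M[k]_q) (B' : 'M_(r', q)) (U : 'M_(p, q)) :
  (Z *m U <= Z')%MS -> (B' <= Z')%MS ->
  (forall x : 'rV_p, (x <= Z)%MS -> (x *m U <= B')%MS -> (x <= B)%MS) ->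
  (\rank Z - \rank B <= \rank Z' - \rank B')%N.
Proof.
move=> ZU BZ' inj; pose C := cokermx B'.
have le1 : (\rank (Z *m U *m C) <= \rank (Z' *m C))%N by apply/mxrankS/submxMr.
have le2 : (\rank B' <= \rank (Z' :&: kermx C))%N.
  by apply/mxrankS; rewrite sub_capmx BZ'; apply/sub_kermxP; apply: mulmx_coker.
have le3 : (\rank (Z :&: kermx (U *m C)) <= \rank B)%N.
  apply/mxrankS/row_subP => i; apply: inj.
    exact: submx_trans (row_sub _ _) (capmxSl _ _).
  have /sub_kermxP : (row i (Z :&: kermx (U *m C))%MS <= kermx (U *m C))%MS.
    exact: submx_trans (row_sub _ _) (capmxSr _ _).
  by rewrite mulmxA /C submxE => ->.
have := mxrank_mul_ker Z (U *m C); rewrite mulmxA => <-.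
have := mxrank_mul_ker Z' C => <-.
rewrite leq_subLR (leq_trans (leq_add le1 le3)) // addnC leq_add2l.
by rewrite -addnBA // leq_addr.
Qed.

Section Comparison.
Variables (k : fieldType) (R : comAlgType k) (gr : nat -> set R).
Hypothesis hgr : standard_graded gr.

Local Notation hc := (hc hgr).
Local Notation residue := (residue gr).
Local Notation rs := (map_mx residue).

Lemma homog_mulmx p q r (e : 'I_p -> int) (d : 'I_q -> int) (c : 'I_r -> int)
    (A : 'M_(p, q)) (B : 'M_(q, r)) :
  homog_mx gr e d A -> homog_mx gr d c B -> homog_mx gr e c (A *m B).
Proof.
move=> hA hB a b; rewrite mxE; apply: (grz_sum hgr) => s _.
by rewrite -(subrK (d s) (e a)) -addrA; apply: (grzM hgr).
Qed.

Lemma homog_sub p q (e : 'I_p -> int) (d : 'I_q -> int) (A B : 'M_(p, q)) :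
  homog_mx gr e d A -> homog_mx gr e d B -> homog_mx gr e d (A - B).
Proof.
move=> hA hB a b; rewrite !mxE; apply: (grzD hgr) => //; exact: (grzN hgr).
Qed.

Lemma homog_1 p (e : 'I_p -> int) : homog_mx gr e e 1%:M.
Proof.
move=> a b; rewrite mxE; case: eqP => [->|_]; last exact: (grz0 hgr).
by rewrite subrr -[_%:R]scale1r; apply: (gr_scalar hgr).
Qed.

(** A homogeneous entry has nonzero residue only between basis vectors of equal degree, so reduction
    commutes with the projections onto degree [j]. *)
Lemma homog_degree_part p q (e : 'I_p -> int) (d : 'I_q -> int) (A : 'M_(p, q)) (j : int) :
  homog_mx gr e d A ->
  diag_mx (\row_a (e a == j)%:R) *m rs A = rs A *m diag_mx (\row_a (d a == j)%:R).
Proof.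
move=> hA; apply/matrixP => a b; rewrite mul_diag_mx mul_mx_diag !mxE.
have [ea|nea] := eqVneq (e a) (d b); first by rewrite ea mulrC.
rewrite (residue_grz hgr _ (hA a b)) ?mulr0 ?mul0r //.
by rewrite subr_eq0.
Qed.

Variable I : submodClosed R^o.
Hypothesis hI : homogeneous_ideal gr I.

Lemma homogeneous_hc x j : x \in I -> hc j x \in I.
Proof.
move=> /hI[n [f [hf e]]]; case: j => [t|t]; last exact: (rpred0 I).
have -> : hc t x = if (t < n)%N then f t else 0.
  exact: (hcn_uniq hgr (fun t => (hf t).1) e).
case: ifP => _.
  by case: (hf t).
exact: (rpred0 I).
Qed.

Local Notation res := (graded_resolution gr (quot_gr gr (I := I))).
Local Notation "F .-dg i" := (@dg _ _ _ _ _ F i) (at level 2, i at level 1).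
Implicit Types F G : res.

Lemma modquot_pi_sum (T : Type) (r : seq T) (F : T -> R^o) :
  \sum_(i <- r) \pi_(modquot I)%qT (F i) = \pi_(modquot I)%qT (\sum_(i <- r) F i).
Proof.
elim: r => [|x r IH]; last by rewrite !big_cons modquot_piD IH.
by rewrite !big_nil; apply/esym/raddf0.
Qed.

Lemma modquot_scaleE (a : R) (x : R^o) :
  a *: \pi_(modquot I)%qT x = \pi_(modquot I)%qT (a *: x).
Proof. exact: modquot_piZ. Qed.

Lemma aug_lift F j y : quot_gr gr (I := I) j y ->
  exists2 w : 'rV_(rk F 0), (forall c, grz gr (j - F.-dg 0 c) (w 0 c)) &
    y = \sum_c w 0 c *: aug c.
Proof.
case=> r hr <-.
have /choice[s hs] : forall c, exists s, grz gr (F.-dg 0 c) s /\ \pi_(modquot I)%qT s = aug c.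
  by move=> c; have [s h1 h2] := aug_deg c; exists s.
have sumE (w : 'rV[R]_(rk F 0)) :
    \sum_c w 0 c *: aug c = \pi_(modquot I)%qT (\sum_c w 0 c * s c : R^o).
  rewrite -modquot_pi_sum; apply: eq_bigr => c _.
  by have [_ <-] := hs c; rewrite modquot_scaleE.
(* The congruence modulo [I] is projected to degree [j], as homogeneity of [I] permits; this
   replaces the coefficients by homogeneous ones. *)
have [w] := aug_surj F (\pi_(modquot I)%qT (r : R^o)); rewrite sumE => /eqP.
rewrite -modquot_eq => /(homogeneous_hc j); rewrite hcB hc_id // hc_sum => hw.
exists (hcv hgr (F.-dg 0) j w); first by move=> c; rewrite mxE; apply: hc_grz.
apply/eqP; rewrite sumE -modquot_eq; apply: etrans hw; congr (_ - _ \in I).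
apply: eq_bigr => c _; have [hsc _] := hs c; by rewrite mxE (hcMr hgr _ _ hsc).
Qed.

Lemma homog_row_lift p q r (e : 'I_p -> int) (d : 'I_q -> int) (c : 'I_r -> int)
    (A : 'M[R]_(p, r)) (D : 'M[R]_(q, r)) :
  homog_mx gr e c A -> homog_mx gr d c D -> (forall a, exists w, row a A = w *m D) ->
  exists2 W : 'M_(p, q), homog_mx gr e d W & A = W *m D.
Proof.
move=> hA hD /choice[w hw].
exists (\matrix_a hcv hgr d (e a) (w a)); first by move=> a b; rewrite !mxE; apply: hc_grz.
apply/row_matrixP => a; rewrite row_mul rowK -(hcv_mulmx hgr _ _ hD) -hw.
by rewrite (hcv_id hgr) // => b; rewrite mxE.
Qed.

Lemma exact_lift F i p (e : 'I_p -> int) (A : 'M_(p, rk F i.+1)) :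
  homog_mx gr e (F.-dg i.+1) A -> A *m dif F i = 0 ->
  exists2 W, homog_mx gr e (F.-dg i.+2) W & A = W *m dif F i.+1.
Proof.
move=> hA A0; apply: homog_row_lift hA _ _; first by move=> a b; apply: dif_deg.
by move=> a; apply/dif_exact; rewrite -row_mul A0 row0.
Qed.

Lemma exact_lift0 F p (e : 'I_p -> int) (A : 'M_(p, rk F 0)) :
  homog_mx gr e (F.-dg 0) A -> (forall a, \sum_c A a c *: aug c = 0) ->
  exists2 W, homog_mx gr e (F.-dg 1) W & A = W *m dif F 0.
Proof.
move=> hA A0; apply: homog_row_lift hA _ _; first by move=> a b; apply: dif_deg.
move=> a; apply/aug_exact; rewrite -[RHS](A0 a).
by apply: eq_bigr => c _; rewrite mxE.
Qed.

Lemma dif_dif F i : dif F i.+1 *m dif F i = 0.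
Proof.
apply/row_matrixP => a; rewrite row_mul row0; apply/dif_exact.
by exists (delta_mx 0 a); rewrite -rowE.
Qed.

Lemma dif_aug F a : \sum_c dif F 0 a c *: aug c = 0.
Proof.
rewrite (eq_bigr (fun c => (row a (dif F 0)) 0 c *: aug c)) => [|c _]; last by rewrite mxE.
by apply/aug_exact; exists (delta_mx 0 a); rewrite -rowE.
Qed.

Lemma aug_mulmx F p q (A : 'M[R]_(p, q)) (B : 'M_(q, rk F 0)) a :
  \sum_c (A *m B) a c *: aug c = \sum_b A a b *: \sum_c B b c *: aug c.
Proof.
under eq_bigr => c _ do rewrite mxE scaler_suml.
rewrite exchange_big; apply: eq_bigr => b _; rewrite scaler_sumr.
by apply: eq_bigr => c _; rewrite scalerA.
Qed.

Record chain_map F G := ChainMap {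
  cm : forall i, 'M[R]_(rk F i, rk G i);
  cm_homog : forall i, homog_mx gr (F.-dg i) (G.-dg i) (cm i);
  cm_aug : forall a, \sum_c cm 0 a c *: aug c = aug a;
  cm_dif : forall i, dif F i *m cm i = cm i.+1 *m dif G i
}.

Lemma comparison F G : inhabited (chain_map F G).
Proof.
have /choice[w hw] : forall a : 'I_(rk F 0), exists w : 'rV_(rk G 0),
    (forall c, grz gr (F.-dg 0 a - G.-dg 0 c) (w 0 c)) /\
    aug a = \sum_c w 0 c *: aug c.
  by move=> a; have [w h1 h2] := aug_lift G (aug_deg a); exists w.
pose u0 : 'M[R]_(rk F 0, rk G 0) := \matrix_a w a.
have hu0 : homog_mx gr (F.-dg 0) (G.-dg 0) u0.
  by move=> a c; rewrite mxE; case: (hw a).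
have au0 a : \sum_c u0 a c *: aug c = aug a.
  by case: (hw a) => _ ->; apply: eq_bigr => c _; rewrite mxE.
(* The invariant already contains the solution [W] of the next square, which is the matrix chosen in
   the next step. *)
pose P i (u : 'M[R]_(rk F i, rk G i)) := homog_mx gr (F.-dg i) (G.-dg i) u /\
  exists2 W, homog_mx gr (F.-dg i.+1) (G.-dg i.+1) W & dif F i *m u = W *m dif G i.
pose Q i (u : 'M[R]_(rk F i, rk G i)) (u' : 'M[R]_(rk F i.+1, rk G i.+1)) :=
  dif F i *m u = u' *m dif G i.
have dh F' i : homog_mx gr (F'.-dg i.+1) (F'.-dg i) (dif F' i) by move=> a b; apply: dif_deg.
have [||u [u0E uP uQ]] := @dep_choice _ P Q u0.
- split=> //; apply: exact_lift0; first exact: homog_mulmx (dh _ _) hu0.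
  move=> a; rewrite aug_mulmx; under eq_bigr => b _ do rewrite au0.
  exact: dif_aug.
- move=> i x [hx [W hW e]]; exists W; split=> //; split=> //.
  apply: exact_lift; first exact: homog_mulmx (dh _ _) hW.
  by rewrite -mulmxA -e mulmxA dif_dif mul0mx.
have au a : \sum_c u 0%N a c *: aug c = aug a by rewrite u0E.
by exists; exact: (@ChainMap F G u (fun i => (uP i).1) au uQ).
Qed.

Lemma homotopy F (w : chain_map F F) : exists h : forall i, 'M[R]_(rk F i, rk F i.+1),
  [/\ forall i, homog_mx gr (F.-dg i) (F.-dg i.+1) (h i),
      cm w 0 - 1%:M = h 0%N *m dif F 0 &
      forall i, cm w i.+1 - 1%:M = dif F i *m h i + h i.+1 *m dif F i.+1].
Proof.
have dh i : homog_mx gr (F.-dg i.+1) (F.-dg i) (dif F i) by move=> a b; apply: dif_deg.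
have hw i : homog_mx gr (F.-dg i) (F.-dg i) (cm w i - 1%:M).
  by apply: homog_sub (homog_1 _); apply: cm_homog.
have [h0 hh0 e0] : exists2 h0, homog_mx gr (F.-dg 0) (F.-dg 1) h0 & cm w 0 - 1%:M = h0 *m dif F 0.
  apply: exact_lift0 => // a.
  under eq_bigr => c _ do rewrite 2!mxE scalerBl.
  rewrite sumrB (cm_aug w) (bigD1 a) //= mxE eqxx scale1r big1 ?addr0 ?subrr // => c ne.
  by rewrite mxE eq_sym (negPf ne) scale0r.
(* The vanishing in the invariant makes [cm w i.+1 - 1%:M - dif F i *m h] a cycle, so that exactness
   yields the next homotopy matrix. *)
pose P i (h : 'M[R]_(rk F i, rk F i.+1)) := homog_mx gr (F.-dg i) (F.-dg i.+1) h /\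
  dif F i *m (cm w i - 1%:M - h *m dif F i) = 0.
pose Q i (h : 'M[R]_(rk F i, rk F i.+1)) (h' : 'M[R]_(rk F i.+1, rk F i.+2)) :=
  cm w i.+1 - 1%:M = dif F i *m h + h' *m dif F i.+1.
have [||h [h0E hP hQ]] := @dep_choice _ P Q h0.
- by split=> //; rewrite e0 subrr mulmx0.
- move=> i x [hx ex].
  have [||h' hh' e'] := @exact_lift F i _ (F.-dg i.+1) (cm w i.+1 - 1%:M - dif F i *m x).
  + by apply: homog_sub => //; apply: homog_mulmx (dh i) hx.
  + by rewrite !mulmxBl -(cm_dif w) mul1mx -mulmxA -[X in _ - X - _]mulmx1 -!mulmxBr.
  exists h'; split; last by rewrite /Q -e' [RHS]addrC subrK.
  by split=> //; rewrite -e' opprB addrCA subrr addr0 mulmxA dif_dif mul0mx.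
by exists h; split=> [i||//]; [case: (hP i) | rewrite h0E].
Qed.

(** Comparison maps in both directions compose to a map homotopic to the identity, so the map
    induced on Tor is injective. Exchanging [F] and [G] gives the opposite inequality. *)
Lemma tor_dim_le F G i j : (tor_dim F i j <= tor_dim G i j)%N.
Proof.
have dh F' n : homog_mx gr (F'.-dg n.+1) (F'.-dg n) (dif F' n) by move=> a b; apply: dif_deg.
have [u] := comparison F G; have [v] := comparison G F.
have w1 n : homog_mx gr (F.-dg n) (F.-dg n) (cm u n *m cm v n).
  exact: homog_mulmx (@cm_homog _ _ u n) (@cm_homog _ _ v n).
have w2 a : \sum_c (cm u 0 *m cm v 0) a c *: aug c = aug a.
  by rewrite aug_mulmx; under eq_bigr => b _ do rewrite (cm_aug v); apply: cm_aug.
have w3 n : dif F n *m (cm u n *m cm v n) = cm u n.+1 *m cm v n.+1 *m dif F n.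
  by rewrite mulmxA cm_dif -mulmxA cm_dif mulmxA.
have [w wE] : exists w : chain_map F F, forall n, cm w n = cm u n *m cm v n.
  by exists (ChainMap w1 w2 w3).
have [h [hh h0 hS]] := homotopy w.
pose DF n := degree_part F n j; pose DG n := degree_part G n j.
have DD F' n : degree_part F' n j *m degree_part F' n j = degree_part F' n j.
  rewrite /degree_part mul_diag_mx; apply/matrixP => a b; rewrite !mxE.
  by case: eqP => _; rewrite ?mul0rn ?mul0r ?mul1r.
have DdF F' n : degree_part F' n.+1 j *m tor_dif F' n = tor_dif F' n *m degree_part F' n j.
  exact: homog_degree_part.
have inD F' n (x : 'rV_(rk F' n)) : (x <= degree_part F' n j)%MS -> x *m degree_part F' n j = x.
  by move=> /submxP[y ->]; rewrite -mulmxA DD.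
have tt F' n : tor_dif F' n.+1 *m tor_dif F' n = 0.
  rewrite /tor_dif -(residue_mulmx hgr) dif_dif.
  by apply/matrixP => a b; rewrite !mxE (residue0 hgr).
have BZ : (tor_boundaries G i j <= tor_cycles G i j)%MS.
  have DB : (tor_boundaries G i j <= degree_part G i j)%MS by rewrite /tor_boundaries DdF submxMl.
  case: i DB => [//|i] DB; rewrite sub_capmx DB; apply/sub_kermxP.
  by rewrite /tor_boundaries -mulmxA tt mulmx0.
have cmF F' G' (u' : chain_map F' G') n :
    tor_dif F' n *m rs (cm u' n) = rs (cm u' n.+1) *m tor_dif G' n.
  by rewrite -!(residue_mulmx hgr) cm_dif.
have cmD F' G' (u' : chain_map F' G') n :
    degree_part F' n j *m rs (cm u' n) = rs (cm u' n) *m degree_part G' n j.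
  by apply: homog_degree_part; apply: cm_homog.
have cycD F' (x : 'rV_(rk F' i)) : (x <= tor_cycles F' i j)%MS -> x *m degree_part F' i j = x.
  move=> hx; apply: inD; clear BZ; case: i x hx => [//|i] x; by rewrite sub_capmx => /andP[].
apply: (@subquotient_rank _ _ _ _ _ _ _ _ _ (rs (cm u i))) => //.
  apply/row_subP => a; rewrite row_mul.
  have := row_sub a (tor_cycles F i j); move: (row a _) => x hx.
  have hD : (x *m rs (cm u i) <= degree_part G i j)%MS.
    by rewrite -(cycD _ _ hx) -mulmxA cmD mulmxA submxMl.
  clear a BZ cycD; case: i x hx hD => [//|i] x hx hD; rewrite sub_capmx hD.
  apply/sub_kermxP; rewrite -mulmxA -cmF mulmxA.
  by move: hx; rewrite sub_capmx => /andP[_ /sub_kermxP ->]; rewrite mul0mx.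
move=> x hx /submxP[y ey].
have key : x *m rs (cm w i) = x + x *m rs (h i) *m tor_dif F i.
  have rs1 n : rs (1%:M : 'M_(rk F n)) = 1%:M.
    by apply/matrixP => a b; rewrite !mxE; case: eqP; rewrite ?(residue1 hgr) ?(residue0 hgr).
  have rsD p q (A B : 'M[R]_(p, q)) : rs (A + B) = rs A + rs B.
    by apply/matrixP => a b; rewrite !mxE (residueD hgr).
  clear BZ cycD y ey; case: i x hx => [|i] x hx.
    rewrite -[cm w 0](subrK 1%:M) h0 rsD rs1 (residue_mulmx hgr) mulmxDr mulmx1.
    by rewrite addrC mulmxA.
  rewrite -[cm w i.+1](subrK 1%:M) hS !rsD rs1 !(residue_mulmx hgr) !mulmxDr mulmx1.
  move: hx; rewrite sub_capmx => /andP[_ /sub_kermxP hx].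
  by rewrite mulmxA hx mul0mx add0r addrC mulmxA.
(* Both terms are boundaries: the first is the image under [v] of the boundary that [x] becomes in
   [G], the second comes from the homotopy. *)
have -> : x = x *m rs (cm w i) - x *m rs (h i) *m tor_dif F i by rewrite key addrK.
rewrite addmx_sub ?eqmx_opp //.
  rewrite wE (residue_mulmx hgr) mulmxA ey /tor_boundaries -!mulmxA cmF.
  by rewrite [X in _ *m X]mulmxA cmD -mulmxA mulmxA submxMl.
rewrite -{1}(cycD _ _ hx) -(mulmxA x) /tor_boundaries.
rewrite (homog_degree_part j (hh i)) mulmxA -mulmxA; exact: submxMl.
Qed.

Lemma betti_eq F i j : betti gr (quot_gr gr (I := I)) i j = tor_dim F i j.
Proof.
rewrite /betti; case: xgetP => [d _ [G ->]|/(_ (tor_dim F i j)) []]; last by exists F.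
by apply/eqP; rewrite eqn_leq !tor_dim_le.
Qed.

End Comparison.

(** * The Hilbert-Burch theorem *)

Section HilbertBurch.
Variable A : comNzRingType.

Lemma zero_ideal : is_ideal [set 0 : A].
Proof. by split=> [|x y -> ->|a x ->] //=; rewrite ?addr0 ?mulr0. Qed.

Lemma principal_ideal (d : A) : is_ideal [set x | exists z, x = d * z].
Proof.
split=> [|_ _ [z ->] [z' ->]|a _ [z ->]].
- by exists 0; rewrite mulr0.
- by exists (z + z'); rewrite mulrDr.
- by exists (a * z); rewrite mulrCA.
Qed.

(* Elements of square zero are killed by a common nonzero element, so they
   cannot generate a faithful ideal. *)
Lemma square_zero_annihilator (s : seq A) : (forall a, a \in s -> a * a = 0) ->
  exists2 x : A, x != 0 & forall a, a \in s -> x * a = 0.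
Proof.
elim: s => [|a s IH] h; first by exists 1 => //; apply: oner_neq0.
have [|x x0 xs] := IH; first by move=> b bs; apply: h; rewrite inE bs orbT.
have [xa|xa] := eqVneq (x * a) 0.
  by exists x => // b; rewrite inE => /orP[/eqP->|/xs].
exists (x * a) => // b; rewrite inE => /orP[/eqP->|/xs e].
  by rewrite -mulrA h ?mulr0 // inE eqxx.
by rewrite mulrAC e mul0r.
Qed.

Lemma colsub_mulmx n m p (phi : 'M[A]_(n, m)) (g : 'I_p -> 'I_m) :
  mxsub id g phi = phi *m mxsub id g 1%:M.
Proof. by rewrite -[in LHS](mulmx1 phi) mxsub_mul mxsub_id. Qed.

Section Syzygies.
Variables (n m : nat) (phi : 'M[A]_(n, m)) (f : 'cV[A]_m).
Hypothesis inj : forall w : 'rV_n, w *m phi = 0 -> w = 0.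
Hypothesis phif : phi *m f = 0.
Hypothesis ex : forall v : 'rV_m, v *m f = 0 -> exists w, v = w *m phi.

Let minor (g : 'I_n -> 'I_m) := \det (mxsub id g phi).

Let minor_kills (y : 'rV_n) g : y *m mxsub id g phi = 0 -> minor g *: y = 0.
Proof. by move=> e; rewrite -mul_mx_scalar -mul_mx_adj mulmxA e mul0mx. Qed.

(** By the adjugate, the minor on the columns [g] times [y] is determined by the entries of [v] in
    those columns; if these vanish, the minor kills [y] and hence [v]. *)
Let minor_kills_entry (y : 'rV_n) (v : 'rV_m) g l : v = y *m phi -> (forall s, v 0 (g s) = 0) ->
  minor g * v 0 l = 0.
Proof.
move=> e v0; have /minor_kills h : y *m mxsub id g phi = 0.
  by rewrite colsub_mulmx mulmxA -e -colsub_mulmx; apply/rowP => s; rewrite !mxE.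
by rewrite e; have /rowP/(_ l) := congr1 (mulmx^~ phi) h; rewrite /= -scalemxAl mul0mx !mxE.
Qed.

Lemma minors_faithful x : (forall g, x * minor g = 0) -> x = 0.
Proof.
apply: (mccoy zero_ideal) => y h i; have /rowP/(_ i) -> : y = 0; last by rewrite mxE.
by apply: inj; apply/rowP => j; rewrite h mxE.
Qed.

(** With more rows than columns every choice of [n] columns repeats one, so all minors vanish and
    McCoy gives 1 = 0. *)
Lemma syzygy_rank_le : (n <= m)%N.
Proof.
rewrite leqNgt; apply/negP => lt; have := oner_neq0 A; apply/negP; rewrite negbK; apply/eqP.
apply: minors_faithful => g; rewrite mul1r.
have /injectivePn[s [t st e]] : ~~ injectiveb g.
  apply/injectiveP => /leq_card; rewrite !card_ord leqNgt lt //.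
rewrite /minor -det_tr; apply: (determinant_alternate st) => a; by rewrite !mxE e.
Qed.

(** If [x] kills every [f j], then [x] times any basis vector is a combination of the rows of [phi].
    For an index [l] outside the columns [g] it vanishes on them, so the minor kills [x]. *)
Lemma ideal_faithful x : (n < m)%N -> (forall j, x * f j 0 = 0) -> x = 0.
Proof.
move=> lt xf; apply: minors_faithful => g; have [l hl] := ord_missed g lt.
have [|y hy] := @ex (x *: delta_mx 0 l).
  by rewrite -scalemxAl -rowE; apply/rowP => a; rewrite ord1 !mxE xf.
have := @minor_kills_entry _ _ g l hy; rewrite !mxE !eqxx mulr1 mulrC; apply=> s.
by rewrite !mxE eqxx /= (negPf (introN eqP (hl s))) mulr0.
Qed.

Lemma koszul_syzygy j l : exists y : 'rV_n,
  f j 0 *: delta_mx 0 l - f l 0 *: delta_mx 0 j = y *m phi.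
Proof.
apply: ex; rewrite mulmxBl -!scalemxAl -!rowE; apply/rowP => a.
by rewrite ord1 !mxE mulrC subrr.
Qed.

(** With two columns to spare outside every [g], Koszul relations show that the square of each minor
    kills all [f j], hence is 0. Minors of square zero have a common nonzero annihilator, against
    McCoy. *)
Lemma syzygy_corank_le1 : (m <= n.+1)%N.
Proof.
rewrite leqNgt; apply/negP => lt.
have sq g : minor g * minor g = 0.
  apply: ideal_faithful => [|s]; first exact: ltnW.
  have [l hl] := ord_missed g (ltnW lt).
  pose g' (t : 'I_n.+1) := if unlift ord0 t is Some t' then g t' else l.
  have [j hj] := ord_missed g' lt.
  have jl : j <> l by move=> e; apply: (hj ord0); rewrite /g' unlift_none.
  have gj t : g t <> j by move=> e; apply: (hj (lift ord0 t)); rewrite /g' liftK.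
  (* The relation between [l] and [j] avoids the columns [g], so the minor kills its entry
     [f l 0]. *)
  have fl : minor g * f l 0 = 0.
    have [y hy] := koszul_syzygy l j.
    have := @minor_kills_entry _ _ g j hy; rewrite !mxE !eqxx /=.
    rewrite (negPf (introN eqP jl)) mulr0 subr0 mulr1; apply => t; rewrite !mxE !eqxx /=.
    by rewrite (negPf (introN eqP (gj t))) (negPf (introN eqP (hl t))) !mulr0 subrr.
  (* After multiplication by the minor, the relation between [s] and [l] keeps only its entry at
     [l], and the minor kills that too. *)
  have [y hy] := koszul_syzygy s l.
  have hy' : (minor g * f s 0) *: delta_mx 0 l = (minor g *: y) *m phi.
    by rewrite -scalemxAl -hy scalerBr !scalerA fl scale0r subr0.
  have := @minor_kills_entry _ _ g l hy'; rewrite !mxE !eqxx mulr1 mulrA; apply => t.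
  by rewrite !mxE !eqxx /= (negPf (introN eqP (hl t))) mulr0.
have [|x x0 xs] := @square_zero_annihilator [seq minor g | g : {ffun 'I_n -> 'I_m}].
  by move=> _ /codomP[g ->].
move/eqP: x0; apply; apply: minors_faithful => g.
have -> : minor g = minor (finfun g).
  by congr (\det _); apply/matrixP => a b; rewrite !mxE ffunE.
by apply: xs; apply: codom_f.
Qed.

(* A nonzerodivisor [d] of the base stays one on the ideal generated by [f],
   so [phi] remains injective modulo [d]. *)
Lemma syzygy_inj_mod d (y : 'rV_n) : (forall x, d * x = 0 -> x = 0) ->
  (forall j, exists z, (y *m phi) 0 j = d * z) -> forall i, exists z, y 0 i = d * z.
Proof.
move=> nzd /choice[z hz] i.
pose zv : 'rV_m := \row_j z j.
have e : y *m phi = d *: zv by apply/rowP => j; rewrite hz !mxE.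
have [|w hw] := @ex zv.
  apply/rowP => a; rewrite ord1 [RHS]mxE; apply: nzd.
  have := congr1 (fun M : 'M_1 => M 0 0) (congr1 (mulmx^~ f) e).
  by rewrite /= -mulmxA phif mulmx0 -scalemxAl !mxE => <-.
have : y - d *: w = 0 by apply: inj; rewrite mulmxBl e hw -scalemxAl subrr.
by move=> /eqP; rewrite subr_eq0 => /eqP ->; exists (w 0 i); rewrite mxE.
Qed.
End Syzygies.

(** By the adjugate the determinant kills [f], and every minor of full size is a multiple of the
    determinant, so McCoy applies. *)
Lemma syzygy_square_eq0 n (phi : 'M[A]_n) (f : 'cV[A]_n) :
  (forall w : 'rV_n, w *m phi = 0 -> w = 0) -> phi *m f = 0 -> f = 0.
Proof.
move=> inj phif; apply/colP => j; rewrite mxE; apply: (minors_faithful inj) => g.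
rewrite colsub_mulmx det_mulmx mulrA (_ : f j 0 * _ = 0) ?mul0r //.
have := congr1 (fun M : 'cV_n => M j 0) (mulmxA (\adj phi) phi f).
by rewrite phif mulmx0 mul_adj_mx mul_scalar_mx !mxE mulrC => <-.
Qed.

Definition signed_minor n (phi : 'M[A]_(n, n.+1)) (i : 'I_n.+1) : A :=
  (-1) ^+ i * \det (col' i phi).

(** Expand along its first row the determinant of [phi] with row [r] repeated on top. *)
Lemma signed_minor_syzygy n (phi : 'M[A]_(n, n.+1)) r :
  \sum_i phi r i * signed_minor phi i = 0.
Proof.
pose B : 'M[A]_(1 + n) := col_mx (row r phi : 'M_(1, 1 + n)) (phi : 'M_(n, 1 + n)).
have Bu i : B ord0 i = phi r i.
  transitivity (B (lshift n ord0) i); first by congr (B _ _); apply: val_inj.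
  by rewrite col_mxEu mxE.
have Bd i : B (lift ord0 r) i = phi r i.
  transitivity (B (rshift 1 r) i); first by congr (B _ _); apply: val_inj.
  by rewrite col_mxEd.
have <- : \det B = \sum_i phi r i * signed_minor phi i.
  rewrite (expand_det_row _ ord0); apply: eq_bigr => i _; rewrite Bu /cofactor add0n.
  congr (_ * (_ * \det _)); apply/matrixP => a b; rewrite [RHS]mxE.
  transitivity (B (rshift 1 a) (lift i b)); last by rewrite col_mxEd.
  by rewrite [LHS]mxE [LHS]mxE; congr (B _ _); apply: val_inj.
apply: (@determinant_alternate _ _ _ ord0 (lift ord0 r)); first by rewrite neq_lift.
by move=> i; rewrite Bu Bd.
Qed.

(** An [n]-tuple of columns misses some column [i], so its minor is a multiple of the signed minor
    at [i], and McCoy modulo [Q] applies. *)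
Lemma signed_minor_faithful n (phi : 'M[A]_(n, n.+1)) (Q : set A) x : is_ideal Q ->
  (forall y : 'rV_n, (forall j, Q ((y *m phi) 0 j)) -> forall i, Q (y 0 i)) ->
  (forall i, Q (x * signed_minor phi i)) -> Q x.
Proof.
move=> iQ inj hx; apply: (mccoy iQ inj) => g.
have [i hi] := ord_missed g (ltnSn n).
have /choice[s hs] : forall t, exists s, g t = lift i s.
  by move=> t; case: (unliftP i (g t)) => [s ->|/hi //]; exists s.
have -> : mxsub id g phi = mxsub id s (col' i phi).
  by apply/matrixP => a b; rewrite !mxE hs.
rewrite colsub_mulmx det_mulmx mulrA; apply: ideal_mulr => //.
have := hx i; rewrite /signed_minor mulrCA => /(ideal_mulr ((-1) ^+ i) iQ).
by rewrite mulrAC -expr2 sqrr_sign mul1r.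
Qed.

End HilbertBurch.

(** The vectors [f] and [D] are proportional. A generic combination [d] of the [D i] is a
    nonzerodivisor, and the factor [a] is the quotient by [d] of the same combination [F] of the
    [f i 0]; McCoy modulo [d] shows that this quotient exists. *)
Lemma hilbert_burch (k : fieldType) (R : comAlgType k) n
    (phi : 'M[R]_(n, n.+1)) (f : 'cV[R]_n.+1) :
  infinite_set [set: k] -> noeth R ->
  (forall w : 'rV_n, w *m phi = 0 -> w = 0) -> phi *m f = 0 ->
  (forall v : 'rV_n.+1, v *m f = 0 -> exists w, v = w *m phi) ->
  exists a, forall j, f j 0 = a * signed_minor phi j.
Proof.
move=> kinf hR inj phif ex; pose D := signed_minor phi.
(* The Koszul relation between [j] and [i] is a combination of rows of [phi], and each row is
   orthogonal to [D]. *)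
have fD i j : f j 0 * D i = f i 0 * D j.
  have [y hy] := koszul_syzygy ex j i; apply/eqP; rewrite -subr_eq0; apply/eqP.
  transitivity (\sum_l (y *m phi) 0 l * D l).
    rewrite -hy; under eq_bigr => l _ do rewrite !mxE mulrBl eqxx /=.
    rewrite sumrB (bigD1 i) //= eqxx mulr1 [X in _ + X - _]big1 ?addr0; last first.
      by move=> l /negPf ->; rewrite mulr0 mul0r.
    rewrite (bigD1 j) //= eqxx mulr1 [X in _ - (_ + X)]big1 ?addr0 //.
    by move=> l /negPf ->; rewrite mulr0 mul0r.
  under eq_bigr => l _ do rewrite mxE mulr_suml.
  rewrite exchange_big big1 // => r _.
  under eq_bigr => l _ do rewrite -mulrA.
  by rewrite -mulr_sumr signed_minor_syzygy mulr0.
have [|t ht] := @generic_nonzerodivisor k R [set 0] _ D kinf hR (zero_ideal R).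
  move=> x hx; apply: (signed_minor_faithful (zero_ideal R) (phi := phi)) => [y h i|i].
    by rewrite (inj y) ?mxE //; apply/rowP => j; rewrite h mxE.
  by rewrite mulrC; apply: hx.
pose d := \sum_i t i *: D i; pose F := \sum_i t i *: f i 0.
have Fd j : F * D j = d * f j 0.
  rewrite !mulr_suml; apply: eq_bigr => i _; rewrite -!scalerAl; congr (_ *: _).
  by rewrite fD mulrC.
(* Each [F * D j] equals [d * f j 0], so lies in (d); as [phi] stays injective modulo [d], [F]
   itself lies in (d). *)
have [|j|a ha] := signed_minor_faithful (phi := phi) (x := F) (principal_ideal d).
- by move=> y hy; apply: (syzygy_inj_mod inj phif ex ht).
- by exists (f j 0).
exists a => j; apply/eqP; rewrite -subr_eq0; apply/eqP; apply: ht.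
by rewrite mulrBr -[X in X - _]Fd ha -mulrA subrr.
Qed.

(** * Resolutions of length two and powers of a regular pair *)

Section ShortResolution.
Variables (k : fieldType) (R : comAlgType k) (gr : nat -> set R).
Hypothesis hgr : standard_graded gr.
Variable I : submodClosed R^o.
Variables (m n : nat) (dg1 : 'I_m -> int) (dg2 : 'I_n -> int).

Definition short_rk (i : nat) : nat :=
  match i with 0 => 1 | 1 => m | 2 => n | _ => 0 end%N.

Definition short_dg (i : nat) : 'I_(short_rk i) -> int :=
  match i with 0 => fun=> 0 | 1 => dg1 | 2 => dg2 | _ => fun=> 0 end.

Variables (f : 'cV[R]_m) (phi : 'M[R]_(n, m)).

Definition short_dif (i : nat) : 'M[R]_(short_rk i.+1, short_rk i) :=
  match i with 0 => f | 1 => phi | _ => 0 end.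

Hypothesis fdg : homog_mx gr dg1 (fun=> 0) f.
Hypothesis phidg : homog_mx gr dg2 dg1 phi.
Hypothesis fI : forall x : R, x \in I <-> exists w : 'rV_m, x = (w *m f) 0 0.
Hypothesis ex : forall v : 'rV_m, v *m f = 0 <-> exists w, v = w *m phi.
Hypothesis inj : forall w : 'rV_n, w *m phi = 0 -> w = 0.

Definition short_aug (b : 'I_(short_rk 0)) : modquot I := \pi_(modquot I)%qT (1 : R^o).

Lemma short_augE (v : 'rV[R]_1) : \sum_b v 0 b *: short_aug b = \pi_(modquot I)%qT (v 0 0 : R^o).
Proof. by rewrite big_ord1 modquot_scaleE [_ *: _]mulr1. Qed.

Definition short_resolution : graded_resolution gr (quot_gr gr (I := I)).
Proof.
refine (@GradedResolution k R gr _ _ short_rk short_dg short_dif short_aug _ _ _ _ _).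
- move=> b; exists 1 => //; rewrite -[1]scale1r; exact: gr_scalar.
- by case=> [|[|i]] a b /=; [apply: fdg | apply: phidg | rewrite mxE; apply: (grz0 hgr)].
- move=> y; exists ((repr y : R)%:M); rewrite short_augE mxE mulr1n; exact/esym/reprK.
- move=> v; rewrite short_augE; split=> [/eqP|[w ->]].
    rewrite (_ : 0 = \pi_(modquot I)%qT (0 : R^o)); last exact/esym/raddf0.
    rewrite -modquot_eq subr0 => /fI[w e]; exists w.
    by apply/rowP => b; rewrite ord1.
  rewrite (_ : 0 = \pi_(modquot I)%qT (0 : R^o)); last exact/esym/raddf0.
  by apply/eqP; rewrite -modquot_eq subr0; apply/fI; exists w.
- case=> [|[|i]] v; first exact: ex.
    split=> [/inj ->|[w ->]]; first by exists 0; rewrite mul0mx.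
    by rewrite /= mulmx0 mul0mx.
  split=> [_|_]; first by exists 0; apply/rowP; case.
  by rewrite mulmx0.
Defined.

(** All differentials vanish after reduction, so Tor in degree [j] is spanned by the basis vectors
    of degree [j]. *)
Lemma tor_dim_short i j : map_mx (residue gr) f = 0 -> map_mx (residue gr) phi = 0 ->
  tor_dim short_resolution i j =
    \rank (diag_mx (\row_a (@short_dg i a == j)%:R : 'rV[k]_(short_rk i))).
Proof.
move=> f0 phi0.
have d0 l : tor_dif short_resolution l = 0.
  case: l => [|[|l]]; rewrite /tor_dif //=.
  by apply/matrixP => a b; rewrite !mxE (residue0 hgr).
rewrite /tor_dim /tor_boundaries d0 mulmx0 mxrank0 subn0.
case: i => [//|i]; rewrite /tor_cycles d0; apply/eqmx_rank.
rewrite capmxSl sub_capmx submx_refl.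
by apply/sub_kermxP; rewrite mulmx0.
Qed.

End ShortResolution.

(** * Powers of an ideal generated by a regular pair *)

Section Ideals.
Variable A : comNzRingType.

Lemma mem_ideal (I : submodClosed A^o) : is_ideal [set x : A | (x : A^o) \in I].
Proof. by split=> [|x y|a x] /=; [apply: rpred0 | apply: rpredD | apply: rpredZ]. Qed.

Lemma ideal_span_sub (S Q : set A) : is_ideal Q -> S `<=` Q ->
  forall x, x \in ideal_span S -> Q x.
Proof.
move=> iQ SQ x /asboolP[n [a [b [hb ->]]]]; apply: ideal_sum => // t _.
by case: iQ => _ _; apply; apply: SQ.
Qed.

Lemma mem_ideal_span (S : set A) x : S x -> x \in ideal_span S.
Proof.
by move=> Sx; apply/asboolP; exists 1%N, (fun=> 1), (fun=> x); rewrite big_ord1 mul1r.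
Qed.

Lemma ideal_span_pairP (g1 g2 x : A) : x \in ideal_span [set` [:: g1; g2]] <->
  exists p q, x = p * g1 + q * g2.
Proof.
split=> [|[p [q ->]]].
  apply: (ideal_span_sub (Q := [set y | exists p q, y = p * g1 + q * g2])) => [|y].
    split=> [|_ _ [p [q ->]] [p' [q' ->]]|a _ [p [q ->]]].
    - by exists 0, 0; rewrite !mul0r addr0.
    - by exists (p + p'), (q + q'); rewrite !mulrDl addrACA.
    - by exists (a * p), (a * q); rewrite mulrDr !mulrA.
  rewrite /= !inE => /orP[]/eqP ->; [exists 1, 0 | exists 0, 1];
    by rewrite mul1r mul0r ?addr0 ?add0r.
have [_ QD QM] := mem_ideal (ideal_span [set` [:: g1; g2]]).
by apply: QD; apply: QM; apply: mem_ideal_span; rewrite /= !inE eqxx ?orbT.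
Qed.

Variables g1 g2 : A.
Local Notation J n := (ideal_exp (ideal_span [set` [:: g1; g2]]) n).

(** Coefficients are indexed by [nat] so that they can be shifted when [n] changes. *)
Definition monomial_comb (n : nat) : set A :=
  [set x | exists w : nat -> A, x = \sum_(i < n.+1) w i * (g1 ^+ (n - i) * g2 ^+ i)].

Lemma monomial_comb_ideal n : is_ideal (monomial_comb n).
Proof.
split=> [|_ _ [w ->] [w' ->]|a _ [w ->]].
- by exists (fun=> 0); rewrite big1 // => i _; rewrite mul0r.
- by exists (fun i => w i + w' i); rewrite -big_split; apply: eq_bigr => i _; rewrite mulrDl.
- by exists (fun i => a * w i); rewrite mulr_sumr; apply: eq_bigr => i _; rewrite mulrA.
Qed.

Lemma monomial_combS n x y : x \in ideal_span [set` [:: g1; g2]] -> monomial_comb n y ->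
  monomial_comb n.+1 (x * y).
Proof.
move=> /ideal_span_pairP[p [q ->]] [w ->].
have [_ QD QM] := monomial_comb_ideal n.+1; rewrite mulrDl -!mulrA.
apply: QD; apply: QM.
  exists (fun i => if (i <= n)%N then w i else 0).
  rewrite [RHS]big_ord_recr /= ltnn mul0r addr0 mulr_sumr; apply: eq_bigr => i _.
  by rewrite -ltnS ltn_ord mulrCA [g1 * (_ * _)]mulrA -exprS -subSn // -ltnS.
exists (fun i => if i is i'.+1 then w i' else 0).
rewrite [RHS]big_ord_recl mul0r add0r mulr_sumr; apply: eq_bigr => i _ /=.
by rewrite subSS exprS mulrCA [g2 * (g1 ^+ _ * _)]mulrCA.
Qed.

Lemma ideal_exp_pairP n x : x \in J n <-> monomial_comb n x.
Proof.
split.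
  apply: ideal_span_sub (monomial_comb_ideal n) _ x => _ [c [hc ->]].
  elim: n c hc => [|n IH] c hc.
    by rewrite big_ord0; exists (fun=> 1); rewrite big_ord1 !expr0 !mulr1.
  by rewrite big_ord_recl; apply: monomial_combS => //; apply: IH.
case=> w ->; apply: (ideal_sum (Q := [set x : A | x \in J n])) (mem_ideal _) _ => i _ /=.
have [_ _ QM] := mem_ideal (J n); apply: QM; apply: mem_ideal_span.
exists (fun s : 'I_n => if (s < n - i)%N then g1 else g2); split=> [s|].
  by case: ifP => _; apply: mem_ideal_span; rewrite /= !inE eqxx ?orbT.
have le_in : (i <= n)%N by rewrite -ltnS.
rewrite -(big_mkord xpredT (fun s => if (s < n - i)%N then g1 else g2)).
rewrite (big_cat_nat _ (leq_subr i n)) //=; congr (_ * _).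
  rewrite big_nat_cond (eq_bigr (fun=> g1)) -?big_nat_cond ?prodr_const_nat ?subn0 //.
  by move=> s; rewrite andbT => /andP[_ ->].
rewrite big_nat_cond (eq_bigr (fun=> g2)) -?big_nat_cond ?prodr_const_nat ?subKn //.
by move=> s; rewrite andbT => /andP[le _]; rewrite ltnNge le.
Qed.

Hypothesis g1_nzd : forall x, g1 * x = 0 -> x = 0.
Hypothesis g2_nzd : forall x, (exists z, g2 * x = g1 * z) -> exists z, x = g1 * z.

Definition power_gens n : 'cV[A]_n.+1 := \col_i (g1 ^+ (n - i) * g2 ^+ i).

(** The bidiagonal Hilbert-Burch matrix of (g1, g2)^n: row [i] says that [g2] times the [i]-th
    monomial is [g1] times the next one. *)
Definition power_syz n : 'M[A]_(n, n.+1) :=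
  \matrix_(i, j) ((j == i :> nat)%:R * g2 - (j == i.+1 :> nat)%:R * g1).

Lemma power_syz_col n (w : 'rV[A]_n) (u : nat -> A) (j : 'I_n.+1) :
  (forall i : 'I_n, w 0 i = u i) -> (w *m power_syz n) 0 j =
  (if (j < n)%N then u j * g2 else 0) - (if j : nat is j'.+1 then u j' * g1 else 0).
Proof.
move=> hw; rewrite mxE.
under eq_bigr => i _ do rewrite hw mxE mulrBr.
rewrite sumrB; congr (_ - _).
  case: ltnP => [lt|le].
    rewrite (bigD1 (Ordinal lt)) //= eqxx mul1r big1 ?addr0 // => i.
    by rewrite -val_eqE /= eq_sym => /negPf ->; rewrite mul0r mulr0.
  rewrite big1 // => i _; rewrite gtn_eqF ?mul0r ?mulr0 //.
  exact: leq_trans (ltn_ord i) le.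
case: j => -[|j] lt /=; first by rewrite big1 // => i _; rewrite mul0r mulr0.
rewrite ltnS in lt; rewrite (bigD1 (Ordinal lt)) //= eqxx mul1r big1 ?addr0 // => i.
by rewrite -val_eqE /= eqSS eq_sym => /negPf ->; rewrite mul0r mulr0.
Qed.

Lemma power_gens_mul n (w : 'rV[A]_n.+1) (u : nat -> A) : (forall i : 'I_n.+1, w 0 i = u i) ->
  (w *m power_gens n) 0 0 = \sum_(i < n.+1) u i * (g1 ^+ (n - i) * g2 ^+ i).
Proof. by move=> hw; rewrite mxE; apply: eq_bigr => i _; rewrite hw mxE. Qed.

Lemma power_syz_gens n : power_syz n *m power_gens n = 0.
Proof.
apply/matrixP => i j; rewrite !mxE.
have lti : (i < n)%N by [].
under eq_bigr => l _ do rewrite !mxE mulrBl.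
rewrite sumrB (bigD1 (widen_ord (leqnSn n) i)) //= eqxx mul1r big1 ?addr0; last first.
  by move=> l; rewrite -val_eqE /= => /negPf ->; rewrite !mul0r.
rewrite (bigD1 (lift ord0 i)) //= eqxx mul1r big1 ?addr0; last first.
  by move=> l; rewrite -val_eqE /= /bump leq0n add1n => /negPf ->; rewrite !mul0r.
rewrite /bump leq0n add1n -(subnSK lti) exprS exprS.
by rewrite [g2 * (g1 * _ * _)]mulrCA -mulrA subrr.
Qed.

Lemma power_syz_inj n (w : 'rV[A]_n) : w *m power_syz n = 0 -> w = 0.
Proof.
move=> e.
pose u (i : nat) := if insub i is Some s then w 0 (s : 'I_n) else 0.
have hu (i : 'I_n) : w 0 i = u i by rewrite /u valK.
(* Column [i + 1] reads u(i+1) g2 - u(i) g1 = 0, so the coefficients vanish from the last one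
   downwards. *)
suff H d i : (n <= i + d)%N -> u i = 0.
  by apply/rowP => i; rewrite hu mxE (H n) // leq_addl.
elim: d i => [|d IH] i le.
  by rewrite /u insubN // -leqNgt -[i]addn0.
have [lt|le'] := ltnP i n; last by rewrite /u insubN // -leqNgt.
have := power_syz_col (Ordinal (lt : (i.+1 < n.+1)%N)) hu; rewrite e mxE /=.
rewrite (IH i.+1) ?addSnnS // mul0r if_same sub0r => /esym/eqP; rewrite oppr_eq0 => /eqP.
by rewrite mulrC => /g1_nzd.
Qed.

(** Modulo [g1] only the last term survives, so regularity gives u(n+1) = g1 z. Adding [z] times the
    last syzygy removes this term, and cancelling [g1] leaves a relation for the exponent [n]. *)
Lemma power_syz_exact n (u : nat -> A) :
  \sum_(i < n.+1) u i * (g1 ^+ (n - i) * g2 ^+ i) = 0 ->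
  exists w : nat -> A, forall j, (j <= n)%N ->
    u j = (if (j < n)%N then w j * g2 else 0) - (if j is j'.+1 then w j' * g1 else 0).
Proof.
elim: n u => [|n IH] u.
  rewrite big_ord1 !expr0 !mulr1 => u0; exists (fun=> 0) => j.
  by rewrite leqn0 => /eqP ->; rewrite ltnn subr0.
rewrite big_ord_recr /= subnn expr0 mul1r => e.
have g2X l x : (exists z, g2 ^+ l * x = g1 * z) -> exists z, x = g1 * z.
  elim: l x => [|l IHl] x; first by rewrite mul1r.
  by rewrite exprSr -mulrA => /IHl /g2_nzd.
have S1 : \sum_(i < n.+1) u i * (g1 ^+ (n.+1 - i) * g2 ^+ i) =
    g1 * \sum_(i < n.+1) u i * (g1 ^+ (n - i) * g2 ^+ i).
  rewrite mulr_sumr; apply: eq_bigr => i _.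
  have le : (i <= n)%N by rewrite -ltnS.
  by rewrite subSn // exprS [RHS]mulrCA [g1 * (_ * _)]mulrA.
have [|z hz] := g2X n.+1 (u n.+1).
  exists (- \sum_(i < n.+1) u i * (g1 ^+ (n - i) * g2 ^+ i)).
  by rewrite mulrN -S1 mulrC; apply/eqP; rewrite -addr_eq0 addrC e.
pose u' i := if i == n then u n + z * g2 else u i.
have [|w hw] := IH u'.
  apply: g1_nzd; rewrite -[RHS]e S1 !big_ord_recr /= /u' eqxx !mulrDr.
  rewrite (eq_bigr (fun i : 'I_n => u i * (g1 ^+ (n - i) * g2 ^+ i))); last first.
    by move=> i _; rewrite ltn_eqF.
  rewrite subnn expr0 mul1r mulrDl mulrDr addrA hz; congr (_ + _).
  by rewrite -!mulrA exprS.
(* The value [- z] at [n] undoes the added multiple of the last syzygy. *)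
exists (fun i => if i == n then - z else w i) => j le.
move: le; rewrite leq_eqVlt => /orP[/eqP ->|].
  by rewrite ltnn eqxx sub0r mulNr opprK hz mulrC.
rewrite ltnS => le; rewrite le; have := hw j le; rewrite /u'.
have [->|nej] := eqVneq j n.
  rewrite ltnn sub0r => hun; rewrite mulNr -[u n](addrK (z * g2)) hun addrC.
  by congr (_ - _); case: (n) => // n'; rewrite ltn_eqF.
rewrite ltn_neqAle nej le /= => ->; congr (_ - _).
by case: j le nej => // j le _; rewrite ltn_eqF.
Qed.

End Ideals.

(** * Pure ideals of codimension two *)

Section Assembly.
Variables (k : fieldType) (R : comAlgType k) (gr : nat -> set R).
Hypothesis hgr : standard_graded gr.

Local Notation residue := (residue gr).

Lemma standard_graded_noeth : noeth R.
Proof. by have [s [_ hs]] := gr_generated hgr; apply: noeth_fgalg hs. Qed.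

Variable I : submodClosed R^o.

Lemma residue_ideal x : homogeneous_ideal gr I -> (1 : R) \notin I -> x \in I -> residue x = 0.
Proof.
move=> hI I1 xI; apply: contrapT => /eqP nz.
have := homogeneous_hc hgr hI 0 xI; rewrite hc_residue => h.
move/negP: I1; apply; have := ideal_scale (residue x)^-1 (mem_ideal I) h.
by rewrite scalerA mulVf // scale1r.
Qed.

Lemma annihilator_modquotE : annihilator (modquot I) = [set x : R | (x : R^o) \in I].
Proof.
apply/seteqP; split=> [r hr|r rI x] /=.
  have /eqP := hr (\pi_(modquot I)%qT (1 : R^o)); rewrite modquot_scaleE.
  rewrite (_ : 0 = \pi_(modquot I)%qT (0 : R^o)); last exact/esym/raddf0.
  by rewrite -modquot_eq subr0 [_ *: _]mulr1.
elim/quotW: x => x; rewrite modquot_scaleE.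
rewrite (_ : 0 = \pi_(modquot I)%qT (0 : R^o)); last exact/esym/raddf0.
apply/eqP; rewrite -modquot_eq subr0 [_ *: _]mulrC; exact: (rpredZ x rI).
Qed.

Lemma module_dim_proper n : module_dim (modquot I) n -> (1 : R) \notin I.
Proof.
case=> -[p [hp _]] _; apply/negP => I1.
by have := hp ord0 1; rewrite annihilator_modquotE /= idealr1 => /(_ I1).
Qed.

(** With [n] = dim R/I, a chain of length [n + 2] in [R] would leave one of length [n + 1] above
    (x), hence above [I]. *)
Lemma codim2_not_in_hypersurface x s : gr s.+1 x -> module_codim (modquot I) 2 ->
  ~ (forall y, y \in I -> exists z, y = x * z).
Proof.
move=> hx [m [n [[chR _] [_ hn] em]]] hI.
have : (n.+1 <= n)%N; last by rewrite ltnn.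
apply: hn; rewrite annihilator_modquotE.
apply: (prime_chain_sub (S' := [set y : R | exists z, y = x * z])).
  by move=> y yI; apply: hI.
apply: (dim_hypersurface hgr standard_graded_noeth hx).
move: chR; rewrite em addn2; apply: prime_chain_sub => y -> a.
by rewrite scale0r.
Qed.

(** Used with [l = 1]: if there were no second syzygies, the projective dimension would be at most
    1. *)
Lemma pdim_le_resolution (F : graded_resolution gr (quot_gr gr (I := I))) l :
  (forall i, (l < i)%N -> rk F i = 0%N) -> pdim_le (modquot I) l.
Proof.
move=> hF.
have [|e he] := @linear_ex R 'rV[R]_(rk F 0) (modquot I) (fun v => \sum_b v 0 b *: aug b).
  move=> c u v; rewrite scaler_sumr -big_split; apply: eq_bigr => b _.
  by rewrite !mxE scalerDl scalerA.
exists (fun i => 'rV[R]_(rk F i)), (fun i => mulmxr (dif F i)), e; split.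
- by move=> i; apply: projective_rV.
- by move=> i /hF e0 x; apply/rowP => b; have : (b < 0)%N by rewrite -e0 ltn_ord.
- by move=> y; have [v ->] := aug_surj F y; exists v.
- by move=> v; rewrite he; apply: aug_exact.
- by move=> i v; apply: dif_exact.
Qed.

(* Projective dimension at most 2 makes the minimal resolution stop after [phi]. *)
Lemma minimal_resolution : homogeneous_ideal gr I -> (1 : R) \notin I ->
  pdim_le (modquot I) 2 ->
  exists m n (f : 'cV[R]_m) (phi : 'M[R]_(n, m)) (dg1 : 'I_m -> int) (dg2 : 'I_n -> int),
  [/\ homog_mx gr dg1 (fun=> 0) f /\ homog_mx gr dg2 dg1 phi,
      forall x : R, x \in I <-> exists w : 'rV_m, x = (w *m f) 0 0,
      forall v : 'rV_m, v *m f = 0 <-> exists w, v = w *m phi,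
      forall w : 'rV_n, w *m phi = 0 -> w = 0 &
      (forall w : 'rV_m, w *m f = 0 -> forall a, residue (w 0 a) = 0) /\
      (map_mx residue f = 0 /\ map_mx residue phi = 0)].
Proof.
move=> hI I1 pd2.
have [||||m [f [dg1 [fdg fN fmin]]]] := @minimal_generators _ _ _ hgr 1 (fun=> 0)
    [set v : 'rV[R]_1 | (v 0 0 : R^o) \in I] standard_graded_noeth.
- by rewrite /= mxE rpred0.
- by move=> u v hu hv; rewrite /= mxE rpredD.
- by move=> a v hv; rewrite /= mxE; apply: (rpredZ a hv).
- by move=> j v hv; rewrite /= mxE; apply: homogeneous_hc.
have [||||n [phi [dg2 [phidg phiN phimin]]]] := @minimal_generators _ _ _ hgr m dg1
    [set v | v *m f = 0] standard_graded_noeth.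
- by rewrite /= mul0mx.
- by move=> u v /= hu hv; rewrite mulmxDl hu hv addr0.
- by move=> a v /= hv; rewrite -scalemxAl hv scaler0.
- move=> j v /= hv; rewrite -(hcv_mulmx hgr _ _ fdg) hv; apply/rowP => b.
  by rewrite !mxE hc0.
have fI (x : R) : x \in I <-> exists w : 'rV_m, x = (w *m f) 0 0.
  split=> [xI|[w ->]]; last by apply/(fN (w *m f)); exists w.
  have /fN[w e] : [set v : 'rV[R]_1 | (v 0 0 : R^o) \in I] x%:M by rewrite /= mxE.
  by exists w; rewrite -e mxE.
exists m, n, f, phi, dg1, dg2; split=> //.
  have [|e he] := @linear_ex R 'rV[R]_1 (modquot I) (fun v => \pi_(modquot I)%qT (v 0 0 : R^o)).
    by move=> c u v; rewrite modquot_scaleE -modquot_piD !mxE.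
  have [||||h [h1 h2]] := @pdim2_retraction _ (modquot I) _ _ _ e (mulmxr f) (mulmxr phi)
      (@projective_rV _ 1) (@projective_rV _ m) (@projective_rV _ n) => //.
  - by elim/quotW => y; exists (y : R)%:M; rewrite he mxE.
  - move=> v; rewrite he; split=> [/eqP|[w ->]].
      rewrite (_ : 0 = \pi_(modquot I)%qT (0 : R^o)); last exact/esym/raddf0.
      by rewrite -modquot_eq subr0 => /fN.
    rewrite (_ : 0 = \pi_(modquot I)%qT (0 : R^o)); last exact/esym/raddf0.
    by apply/eqP; rewrite -modquot_eq subr0; apply/fN; exists w.
  exact: (retraction_nakayama hgr (K := [set w | w *m phi = 0]) h1 h2 phimin).
split=> //; split; apply/matrixP => a b; rewrite !mxE.
  rewrite ord1; apply: residue_ideal => //; apply/fI; exists (delta_mx 0 a).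
  by rewrite -rowE mxE.
have /fmin/(_ b) : row a phi *m f = 0.
  by apply/phiN; exists (delta_mx 0 a); rewrite -rowE.
by rewrite mxE.
Qed.

End Assembly.

Section PureCodim2.
Variables (k : fieldType) (R : comAlgType k) (gr : nat -> set R).
Hypotheses (kinf : infinite_set [set: k]) (hgr : standard_graded gr).

(** Every basis vector of a minimal resolution contributes to a Betti number, which is how purity
    forces equal degrees. *)
Lemma rank_degree_part_neq0 p (e : 'I_p -> int) a :
  \rank (diag_mx (\row_b (e b == e a)%:R) : 'M[k]_p) != 0%N.
Proof.
rewrite mxrank_eq0; apply/eqP => /matrixP/(_ a a); rewrite !mxE !eqxx => /eqP.
by rewrite oner_eq0.
Qed.

Lemma grz_signed_minor n (phi : 'M[R]_(n, n.+1)) c j :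
  (forall a b, grz gr c (phi a b)) -> grz gr (c * n%:Z) (signed_minor phi j).
Proof.
move=> h; rewrite /signed_minor -signr_odd mulr_sign; case: ifP => _; first apply: (grzN hgr).
  by apply: (grz_det hgr) => a b; rewrite mxE.
by apply: (grz_det hgr) => a b; rewrite mxE.
Qed.

Lemma power_ideal_homogeneous (g1 g2 : R) c n : grz gr c g1 -> grz gr c g2 ->
  homogeneous_ideal gr (ideal_exp (ideal_span [set` [:: g1; g2]]) n).
Proof.
move=> h1 h2 x /ideal_exp_pairP[w ->]; set y := \sum_(i < n.+1) _.
have [N hN] := hc_decomp hgr y; exists N, (fun t => hc hgr t y); split; last exact: hN.
move=> t; split; first exact: (hc_grz hgr t%:Z).
(* All monomials in the sum have degree c n, so its component of degree [t] arises from components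
   of the coefficients. *)
apply/ideal_exp_pairP; exists (fun i => hc hgr (t%:Z - c * n%:Z) (w i)).
rewrite hc_sum; apply: eq_bigr => i _; apply: hcMr.
have le : (i <= n)%N by rewrite -ltnS.
have grX l g : grz gr c g -> grz gr (c * l%:Z) (g ^+ l).
  by move=> hg; rewrite -[l in g ^+ l]card_ord -prodr_const; apply: (grz_prod hgr).
rewrite -{1}(subnK le) PoszD mulrDr; apply: (grzM hgr); exact: grX.
Qed.

Lemma betti_power_ideal (g1 g2 : R) c n : grz gr c g1 -> grz gr c g2 ->
  residue gr g1 = 0 -> residue gr g2 = 0 -> (0 < n)%N ->
  (forall x, g1 * x = 0 -> x = 0) ->
  (forall x, (exists z, g2 * x = g1 * z) -> exists z, x = g1 * z) ->
  forall i j, betti gr (quot_gr gr (I := ideal_exp (ideal_span [set` [:: g1; g2]]) n)) i j =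
    \rank (diag_mx (\row_a (@short_dg n.+1 n (fun=> c * n%:Z) (fun=> c * n%:Z + c) i a == j)%:R
       : 'rV[k]_(short_rk n.+1 n i))).
Proof.
move=> h1 h2 r1 r2 n0 nzd1 nzd2 i j; set J := ideal_exp _ n.
have grX l g : grz gr c g -> grz gr (c * l%:Z) (g ^+ l).
  by move=> hg; rewrite -[l in g ^+ l]card_ord -prodr_const; apply: (grz_prod hgr).
have fdg : homog_mx gr (fun=> c * n%:Z) (fun=> 0) (power_gens g1 g2 n).
  move=> a b; rewrite mxE subr0; have le : (a <= n)%N by rewrite -ltnS.
  rewrite -{1}(subnK le) PoszD mulrDr; apply: (grzM hgr); exact: grX.
have phidg : homog_mx gr (fun=> c * n%:Z + c) (fun=> c * n%:Z) (power_syz g1 g2 n).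
  move=> a b; rewrite mxE addrAC subrr add0r; apply: (grzD hgr).
    by case: (_ == _); rewrite ?mul1r ?mul0r //; apply: (grz0 hgr).
  apply: (grzN hgr).
  by case: (_ == _); rewrite ?mul1r ?mul0r //; apply: (grz0 hgr).
have fun_ord (p : nat) (w : 'rV[R]_p) : exists u : nat -> R, forall s : 'I_p, w 0 s = u s.
  by exists (fun s => if insub s is Some t then w 0 t else 0) => s; rewrite valK.
have fI (x : R) : x \in J <-> exists w : 'rV_n.+1, x = (w *m power_gens g1 g2 n) 0 0.
  split=> [/ideal_exp_pairP[w ->]|[w ->]].
    exists (\row_s w s); rewrite (power_gens_mul _ _ (u := w)) // => s; by rewrite mxE.
  by apply/ideal_exp_pairP; have [u hu] := fun_ord _ w; exists u; rewrite (power_gens_mul _ _ hu).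
have ex (v : 'rV_n.+1) : v *m power_gens g1 g2 n = 0 <-> exists w, v = w *m power_syz g1 g2 n.
  split=> [e|[w ->]]; last by rewrite -mulmxA power_syz_gens mulmx0.
  have [u hu] := fun_ord _ v.
  have [|w hw] := power_syz_exact nzd1 nzd2 (n := n) (u := u).
    by rewrite -(power_gens_mul _ _ hu) e mxE.
  exists (\row_s w s); apply/rowP => s; rewrite hu hw; last by rewrite -ltnS.
  by rewrite (power_syz_col _ _ (u := w)) // => t; rewrite mxE.
have inj := power_syz_inj nzd1 (g2 := g2) (n := n).
have hJ := power_ideal_homogeneous (n := n) h1 h2.
rewrite (betti_eq hgr hJ (short_resolution hgr fdg phidg fI ex inj)).
have rX l g : residue gr g = 0 -> (0 < l)%N -> residue gr (g ^+ l) = 0.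
  by case: l => // l rg _; rewrite exprS (residueM hgr) rg mul0r.
apply: tor_dim_short; apply/matrixP => a b; rewrite !mxE.
  rewrite (residueM hgr); case: (posnP a) => [->|a0].
    by rewrite (rX _ g1) ?mul0r // subn0.
  by rewrite (rX _ g2) ?mulr0.
rewrite -mulNr (residueD hgr) !(residueM hgr) r1 r2; by rewrite !mulr0 addr0.
Qed.

Lemma generic_regular_pair n m (phi : 'M[R]_(n.+1, m)) (f : 'cV[R]_m) c :
  (forall w : 'rV_n.+1, w *m phi = 0 -> w = 0) -> phi *m f = 0 ->
  (forall v : 'rV_m, v *m f = 0 -> exists w, v = w *m phi) ->
  (forall a b, grz gr c (phi a b)) -> (forall a b, residue gr (phi a b) = 0) ->
  exists g1 g2 : R, [/\ grz gr c g1 /\ grz gr c g2, residue gr g1 = 0 /\ residue gr g2 = 0,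
    forall x, g1 * x = 0 -> x = 0 &
    forall x, (exists z, g2 * x = g1 * z) -> exists z, x = g1 * z].
Proof.
move=> inj phif ex phidg phires.
have hR := standard_graded_noeth hgr.
pose g (t : 'I_m -> k) := \sum_j t j *: phi ord0 j.
have gdg t : grz gr c (g t) by apply: (grz_sum hgr) => j _; apply: (grzZ hgr).
have gres t : residue gr (g t) = 0.
  rewrite /g (residue_sum hgr) big1 // => j _.
  by rewrite -mulr_algl (residueM hgr) phires mulr0.
(* Injectivity of [phi] on multiples of one basis vector says that only 0 kills the whole first row;
   the same argument is repeated modulo the first chosen element. *)
have row0 (x : R) j : ((x *: delta_mx 0 ord0 : 'rV_n.+1) *m phi) 0 j = phi ord0 j * x.
  by rewrite -scalemxAl -rowE !mxE mulrC.
have [|t1 ht1] := @generic_nonzerodivisor k R [set 0] _ (phi ord0) kinf hR (zero_ideal R).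
  move=> x hx /=; have /rowP/(_ ord0) : x *: delta_mx 0 ord0 = 0 :> 'rV_n.+1.
    by apply: inj; apply/rowP => j; rewrite row0 hx mxE.
  by rewrite !mxE eqxx mulr1.
have [|t2 ht2] := @generic_nonzerodivisor k R _ _ (phi ord0) kinf hR (principal_ideal (g t1)).
  move=> x hx; have := @syzygy_inj_mod _ _ _ phi f inj phif ex (g t1) (x *: delta_mx 0 ord0) ht1.
  move=> /(_ _ ord0); rewrite !mxE eqxx mulr1; apply => j.
  by rewrite row0; apply: hx.
by exists (g t1), (g t2).
Qed.

Lemma regular_sequence_pair (g1 g2 : R) : residue gr g1 = 0 -> residue gr g2 = 0 ->
  (forall x, g1 * x = 0 -> x = 0) ->
  (forall x, (exists z, g2 * x = g1 * z) -> exists z, x = g1 * z) ->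
  regular_sequence [:: g1; g2].
Proof.
move=> r1 r2 nzd1 nzd2; split; last first.
  apply/negP => /ideal_span_pairP[p [q /(congr1 (residue gr))]].
  rewrite (residue1 hgr) (residueD hgr) !(residueM hgr) r1 r2 !mulr0 addr0 => /eqP.
  by rewrite oner_eq0.
have span0 x : x \in ideal_span [set` [::] : seq R] -> x = 0.
  by apply: (ideal_span_sub (zero_ideal R)).
have span1 x : x \in ideal_span [set` [:: g1]] <-> exists z, x = g1 * z.
  split=> [|[z ->]].
    apply: (ideal_span_sub (principal_ideal g1)) => y /=; rewrite inE => /eqP ->.
    by exists 1; rewrite mulr1.
  have [_ _ QM] := mem_ideal (ideal_span [set` [:: g1]]).
  by rewrite mulrC; apply: QM; apply: mem_ideal_span; rewrite /= inE.
case=> [|[|//]] _ x /=.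
  by move=> /span0/nzd1 ->; apply: (rpred0 (ideal_span _)).
by move=> /span1/nzd2/span1.
Qed.

Variable I : submodClosed R^o.

Lemma pure_codim2_betti : homogeneous_ideal gr I -> module_codim (modquot I) 2 ->
  pdim (modquot I) 2 -> pure gr (quot_gr gr (I := I)) ->
  exists n (phi : 'M[R]_(n, n.+1)) (f : 'cV[R]_n.+1) c,
  [/\ (0 < n)%N /\ (forall w : 'rV_n, w *m phi = 0 -> w = 0), phi *m f = 0,
    forall v : 'rV_n.+1, v *m f = 0 -> exists w, v = w *m phi,
    forall a b, grz gr c (phi a b) /\ residue gr (phi a b) = 0 &
    forall i j, betti gr (quot_gr gr (I := I)) i j =
    \rank (diag_mx (\row_a (@short_dg n.+1 n (fun=> c * n%:Z)
        (fun=> c * n%:Z + c) i a == j)%:R : 'rV[k]_(short_rk n.+1 n i)))].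
Proof.
move=> hI cod [pd2 pdmin] hpure.
have hR := standard_graded_noeth hgr.
have I1 : (1 : R) \notin I by case: cod => m [n [_ /(module_dim_proper) h _]].
have [m [n [f [phi [dg1 [dg2 [[fdg phidg] fI ex inj [fmin [f0 phi0]]]]]]]]] :=
  minimal_resolution hgr hI I1 pd2.
pose F := short_resolution hgr fdg phidg fI ex inj.
have bE i j : betti gr (quot_gr gr (I := I)) i j =
    \rank (diag_mx (\row_a (@short_dg m n dg1 dg2 i a == j)%:R : 'rV[k]_(short_rk m n i))).
  by rewrite (betti_eq hgr hI F); apply: tor_dim_short.
have phif : phi *m f = 0.
  apply/row_matrixP => a; rewrite row_mul row0; apply/ex.
  by exists (delta_mx 0 a); rewrite -rowE.
have ex' (v : 'rV_m) : v *m f = 0 -> exists w, v = w *m phi by move=> /ex.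
have c1 a b : dg1 a = dg1 b.
  by apply: (hpure 1%N); rewrite bE; apply: (@rank_degree_part_neq0 _ dg1).
have c2 a b : dg2 a = dg2 b.
  by apply: (hpure 2%N); rewrite bE; apply: (@rank_degree_part_neq0 _ dg2).
have n0 : (0 < n)%N.
  rewrite lt0n; apply/eqP => e; have := pdmin 1%N; rewrite ltnn => /(_ _)/negP; apply; last by [].
  apply: (pdim_le_resolution (F := F)) => -[|[|[|i]]] //.
(* If [f = 0], each basis vector would be a syzygy with a coefficient 1, against minimality. *)
have fnz : (0 < m)%N -> f != 0.
  move=> m0; apply/eqP => e; have := fmin (delta_mx 0 (Ordinal m0)); rewrite e mulmx0.
  by move=> /(_ erefl (Ordinal m0)) /eqP; rewrite mxE !eqxx (residue1 hgr) oner_eq0.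
have le_nm := syzygy_rank_le inj.
have m0 : (0 < m)%N := leq_trans n0 le_nm.
have nenm : n <> m.
  move=> e; subst m; have := fnz m0; rewrite (syzygy_square_eq0 inj phif) eqxx //.
have em : m = n.+1.
  have lt : (n < m)%N by rewrite ltn_neqAle le_nm andbT; apply/eqP.
  by apply/eqP; rewrite eqn_leq lt andbT (syzygy_corank_le1 inj ex').
subst m; pose d := dg1 ord0; pose c := dg2 (Ordinal n0) - d.
have dg1E : dg1 = fun=> d by apply/funext => a; apply: c1.
have dg2E : dg2 = fun=> d + c.
  by apply/funext => a; rewrite addrC subrK; apply: c2.
have phic a b : grz gr c (phi a b) by rewrite /c -(c2 a) /d -(c1 b).
have [a ha] := hilbert_burch kinf hR inj phif ex'.
(* The degree forced on [a], as the [f j 0] have degree [d] and the minors degree c n. Taking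
   components of degree [d] replaces [a] by its component of degree [e]. *)
pose e := d - c * n%:Z.
have fE j : f j 0 = hc hgr e a * signed_minor phi j.
  rewrite -(hcMr hgr _ _ (grz_signed_minor j phic)) -ha hc_id //.
  by have := fdg j 0; rewrite dg1E subr0.
(* A negative [e] would make [f] zero; a positive one would put [I] inside a hypersurface. *)
have e0 : e = 0.
  case ee : e fE (hc_grz hgr e a) => [[//|s]|s]; last first.
    move=> fE _; move/eqP: (fnz m0); case.
    by apply/colP => j; rewrite fE [hc _ _ _]/(0 : R) mul0r mxE.
  move=> fE hs; case: (codim2_not_in_hypersurface hgr hs cod) => y /fI[w ->].
  exists (\sum_j w 0 j * signed_minor phi j).
  rewrite mxE mulr_sumr; apply: eq_bigr => j _.
  by rewrite fE mulrCA.
have dE : d = c * n%:Z by apply/eqP; rewrite -subr_eq0 -/e e0.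
exists n, phi, f, c; split=> // [a' b'|i j].
  by split=> //; move/matrixP: phi0 => /(_ a' b'); rewrite !mxE.
by rewrite bE dg1E dg2E dE.
Qed.

End PureCodim2.

Theorem theorem3p2 (k : fieldType) (R : comAlgType k) (gr : nat -> set R)
    (I : submodClosed R^o) :
  infinite_set [set: k] ->
  standard_graded gr ->
  homogeneous_ideal gr I ->
  module_codim (modquot I) 2 ->
  pdim (modquot I) 2 ->
  pure gr (quot_gr gr (I := I)) ->
  exists (g1 g2 : R) (i : nat),
    [/\ homogeneous gr g1, homogeneous gr g2,
        regular_sequence [:: g1; g2], (0 < i)%N
      & let J := ideal_exp (ideal_span [set` [:: g1; g2]]) i in
        betti gr (quot_gr gr (I := I)) = betti gr (quot_gr gr (I := J))].
Proof.
move=> kinf hgr hI cod pd hpure.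
have [n [phi [f [c [[n0 inj] phif ex phic bE]]]]] :=
  pure_codim2_betti kinf hgr hI cod pd hpure.
case: n n0 phi f inj phif ex phic bE => // n n0 phi f inj phif ex phic bE.
have [g1 [g2 [[d1 d2] [r1 r2] nzd1 nzd2]]] := generic_regular_pair kinf hgr inj phif ex
  (fun a b => (phic a b).1) (fun a b => (phic a b).2).
(* [c] is an integer; a negative value forces [g = 0], which is homogeneous of degree 0. *)
have hom g : grz gr c g -> homogeneous gr g.
  by case: (c) => [s hs|s /= ->]; [exists s | exists 0%N; apply: (gr_zero hgr)].
exists g1, g2, n.+1; split=> //; [exact: hom | exact: hom | exact: (regular_sequence_pair hgr) |].
apply/funext => i; apply/funext => j.
by rewrite bE (betti_power_ideal hgr d1 d2 r1 r2).
Qed.
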